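(* Let $E$ be the elliptic curve over $\mathbb{Q}$ given by $y^2=x^3-708584x^2-1417172x$, of conductor $N_E=2^6\cdot 3\cdot 19\cdot 29\cdot 643$, and let $E'$ be the elliptic curve over $\mathbb{Q}$ given by $y^2=x^3+1417168x^2+502096953744x$. Let $d$ be a positive, square-free integer, prime to $N_E$, and such that the group $E_d(\mathbb{Q})$ is finite, where $E_d$ denotes the quadratic twist of $E$ by $d$. Let $E'_d$ denote the quadratic twist of $E'$ by $d$. Then the $2$-torsion subgroup $\mathrm{Sha}(E'_d)[2]$ of the Tate-Shafarevich group of $E'_d$ over $\mathbb{Q}$ is non-trivial.
   Context: The quadratic twists by $d$ are given explicitly by $$E_d:\ y^2=x^3-708584\,d\,x^2-1417172\,d^2x,\qquad E'_d:\ y^2=x^3+1417168\,d\,x^2+502096953744\,d^2x.$$ $\mathrm{Sha}(F)$ denotes the Tate-Shafarevich group of an elliptic curve $F$ over $\mathbb{Q}$, i.e. the kernel of $H^1(\mathbb{Q},F)\to\prod_v H^1(\mathbb{Q}_v,F)$, where $v$ runs over all places of $\mathbb{Q}$, and $\mathrm{Sha}(F)[2]$ denotes its subgroup of elements killed by $2$. *)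

(* Defs.v *)
From HB Require Import structures.
From mathcomp Require Import all_boot all_order all_algebra all_field.
From mathcomp Require Import boolp classical_sets cardinality reals Rstruct.
From mathcomp Require Import ring.

Set Implicit Arguments.
Unset Strict Implicit.
Unset Printing Implicit Defensive.

Import Order.TTheory GRing.Theory Num.Theory.
Local Open Scope ring_scope.

(* Stdlib's real numbers, which Rstruct makes a realType. *)
Notation real := Rdefinitions.R.

(* The Weierstrass curve y^2 = x^3 + a2 x^2 + a4 x + a6 over Q.  Nonsingularity
   is not bundled: everything below is only meaningful when it holds. *)
Record curve := Curve { a2 : rat; a4 : rat; a6 : rat }.

(* d y^2 = x^3 + a2 x^2 + a4 x + a6, rescaled to be monic. *)
Definition quadratic_twist (F : curve) (d : rat) : curve :=
  Curve (a2 F * d) (a4 F * d ^+ 2) (a6 F * d ^+ 3).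

Section Points.
Variables (F : curve) (L : fieldType).

(* None is the point at infinity.  L is meant to have characteristic 0, so that
   ratr is the embedding of Q in L. *)
Definition on_curve (P : option (L * L)) : bool :=
  if P is Some (x, y) then
    y ^+ 2 == x ^+ 3 + ratr (a2 F) * x ^+ 2 + ratr (a4 F) * x + ratr (a6 F)
  else true.

Record curve_point := Point { coords : option (L * L); _ : on_curve coords }.

HB.instance Definition _ := [isSub for coords].
HB.instance Definition _ := [Equality of curve_point by <:].

Definition opp_coords (P : option (L * L)) : option (L * L) :=
  if P is Some (x, y) then Some (x, - y) else None.

Definition chord_coords (lambda x1 y1 x2 : L) : option (L * L) :=
  let x3 := lambda ^+ 2 - ratr (a2 F) - x1 - x2 in
  Some (x3, lambda * (x1 - x3) - y1).

Definition add_coords (P Q : option (L * L)) : option (L * L) :=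
  match P, Q with
  | None, _ => Q
  | _, None => P
  | Some (x1, y1), Some (x2, y2) =>
      if x1 != x2 then chord_coords ((y2 - y1) / (x2 - x1)) x1 y1 x2
      else if y1 == - y2 then None
      else chord_coords
        ((3 * x1 ^+ 2 + 2 * ratr (a2 F) * x1 + ratr (a4 F)) / (2 * y1)) x1 y1 x2
  end.

Lemma on_opp_coords (P : curve_point) : on_curve (opp_coords (coords P)).
Proof. by case: P => -[[x y]|] //= h; rewrite sqrrN. Qed.

Lemma on_add_coords (P Q : curve_point) :
  on_curve (add_coords (coords P) (coords Q)).
Proof.
case: P Q => -[[x1 y1]|] /= h1 [] [[x2 y2]|] //= h2.
move/eqP: h1 => h1; move/eqP: h2 => h2.
have [e|ne] := eqVneq x1 x2 => /=.
  have [//|ney] := eqVneq y1 (- y2) => /=.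
  have ey : y1 = y2.
    apply/eqP; have : (y1 - y2) * (y1 + y2) = 0.
      by rewrite -subr_sqr h1 h2 e subrr.
    move/eqP; rewrite mulf_eq0 subr_eq0 addr_eq0 (negPf ney) orbF.
    by [].
  subst x2 y2.
  have nz : 2 * y1 != 0 by rewrite mulr_natl mulr2n addr_eq0.
  move: nz h1 {h2 ney}; set l := _ / _ => nz h1.
  have hl : l * (2 * y1) = 3 * x1 ^+ 2 + 2 * ratr (a2 F) * x1 + ratr (a4 F).
    by rewrite /l divfK.
  apply/eqP; apply: (mulfI nz); move: l hl => l hl.
  have e4 : ratr (a4 F) = l * (2 * y1) - 3 * x1 ^+ 2 - 2 * ratr (a2 F) * x1.
    by rewrite hl; ring.
  have e6 : ratr (a6 F)
      = y1 ^+ 2 - x1 ^+ 3 - ratr (a2 F) * x1 ^+ 2 - ratr (a4 F) * x1.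
    by rewrite h1; ring.
  by rewrite e6 e4; ring.
have nz : x2 - x1 != 0 by rewrite subr_eq0 eq_sym.
set l := _ / _.
have hl : y2 = l * (x2 - x1) + y1 by rewrite /l divfK // subrK.
apply/eqP; apply: (mulfI nz); move: l hl => l hl.
have e6 : ratr (a6 F)
    = y1 ^+ 2 - x1 ^+ 3 - ratr (a2 F) * x1 ^+ 2 - ratr (a4 F) * x1.
  by rewrite h1; ring.
have e4 : (x2 - x1) * ratr (a4 F) = y2 ^+ 2 - y1 ^+ 2
    - (x2 ^+ 3 - x1 ^+ 3) - ratr (a2 F) * (x2 ^+ 2 - x1 ^+ 2).
  by rewrite h1 h2; ring.
apply/eqP; rewrite -subr_eq0 e6.
set X := (X in X == 0).
have -> : X = (x2 - x1) * ((l * (x1 - (l ^+ 2 - ratr (a2 F) - x1 - x2)) - y1) ^+ 2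
   - y1 ^+ 2 - (l ^+ 2 - ratr (a2 F) - x1 - x2) ^+ 3 + x1 ^+ 3
   - ratr (a2 F) * ((l ^+ 2 - ratr (a2 F) - x1 - x2) ^+ 2 - x1 ^+ 2))
   - (l ^+ 2 - ratr (a2 F) - x1 - x2 - x1) * ((x2 - x1) * ratr (a4 F)).
  by rewrite /X; ring.
by rewrite e4 hl; apply/eqP; ring.
Qed.

Definition add_point (P Q : curve_point) : curve_point :=
  Point (on_add_coords P Q).
Definition opp_point (P : curve_point) : curve_point :=
  Point (on_opp_coords P).

End Points.

(* F(Q) *)
Definition rational_points (F : curve) : set (curve_point F rat) := setT.
Arguments rational_points F : clear implicits.

Section MapPoint.
Variables (F : curve) (L M : fieldType) (f : {rmorphism L -> M}).

Definition map_coords (P : option (L * L)) : option (M * M) :=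
  if P is Some (x, y) then Some (f x, f y) else None.

Lemma on_map_coords (P : curve_point F L) : on_curve F (map_coords (coords P)).
Proof.
case: P => -[[x y]|] //= /eqP /(congr1 f) h; apply/eqP; move: h.
by rewrite !rmorphD (rmorphM f (ratr _) x) (rmorphM f (ratr _) (x ^+ 2)) !rmorphXn !fmorph_rat.
Qed.

Definition map_point (P : curve_point F L) : curve_point F M :=
  Point (on_map_coords P).

End MapPoint.

Section GaloisCohomology.
Variables (K L : fieldType) (i : {rmorphism K -> L}).

(* Gal(L/K), for L an algebraic closure of K in characteristic 0. *)
Record gal := Gal {
  gal_fun :> {rmorphism L -> L};
  gal_bij : bijective gal_fun;
  gal_fix : forall x, gal_fun (i x) = i x }.

Lemma gal_mul_fix (s t : gal) (x : K) : (s \o t) (i x) = i x.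
Proof. by rewrite /= !gal_fix. Qed.

Definition gal_mul (s t : gal) : gal :=
  @Gal (s \o t) (bij_comp (gal_bij s) (gal_bij t)) (gal_mul_fix s t).

Variable F : curve.

Definition cochain := gal -> curve_point F L.

Definition add_cochain (c c' : cochain) : cochain :=
  fun s => add_point (c s) (c' s).

(* Continuity for the Krull topology on Gal(L/K) and the discrete topology on
   F(L). *)
Definition continuous_cochain (c : cochain) : Prop :=
  forall s : gal, exists S : seq L,
    forall t : gal, {in S, t =1 s} -> c t = c s.

Definition cocycle (c : cochain) : Prop :=
  continuous_cochain c /\
  forall s t : gal, c (gal_mul s t) = add_point (c s) (map_point s (c t)).

(* The class of a cocycle c in H^1(K, F) is zero iff coboundary c. *)
Definition coboundary (c : cochain) : Prop :=
  exists P : curve_point F L,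
    forall s : gal, c s = add_point (map_point s P) (opp_point P).

End GaloisCohomology.

(* algC is the algebraic closure of Q. *)
Notation galQ := (gal (ratr : {rmorphism rat -> algC})).
Notation cochainQ := (cochain (ratr : {rmorphism rat -> algC})).

Section Restriction.
Variables (L : fieldType) (j : {rmorphism algC -> L}).

Lemma restr_subproof (t : {rmorphism L -> L}) (x : algC) :
  exists y : algC, j y == t (j x).
Proof.
have [p [dp _] _] := minCpolyP x.
have [r dr] := closed_field_poly_normal (minCpoly x).
have mj q : map_poly j (map_poly ratr q) = map_poly ratr q.
  by rewrite -map_poly_comp; apply: eq_map_poly => a /=; rewrite fmorph_rat.
have mt (q : {poly rat}) : map_poly t (map_poly ratr q) = map_poly ratr q.
  by rewrite -map_poly_comp; apply: eq_map_poly => a /=; rewrite fmorph_rat.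
have : root (map_poly j (minCpoly x)) (t (j x)).
  by rewrite dp mj -mt fmorph_root -mj fmorph_root -dp root_minCpoly.
have /monicP l1 := minCpoly_monic x.
rewrite dr l1 scale1r rmorph_prod.
rewrite (eq_bigr (fun z => 'X - (j z)%:P)); last first.
  by move=> z _; exact: map_polyXsubC.
rewrite -(big_map j xpredT (fun z => 'X - z%:P)) root_prod_XsubC.
by case/mapP => y _ ->; exists y.
Qed.

Definition restr_fun (t : {rmorphism L -> L}) (x : algC) : algC :=
  xchoose (restr_subproof t x).

Lemma restr_funE (t : {rmorphism L -> L}) x : j (restr_fun t x) = t (j x).
Proof. exact/eqP/(xchooseP (restr_subproof t x)). Qed.

Lemma restr_fun_zmod (t : {rmorphism L -> L}) : zmod_morphism (restr_fun t).
Proof.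
by move=> x y; apply: (fmorph_inj j); rewrite rmorphB !restr_funE !rmorphB.
Qed.

Lemma restr_fun_monoid (t : {rmorphism L -> L}) : monoid_morphism (restr_fun t).
Proof.
split=> [|x y]; apply: (fmorph_inj j); first by rewrite restr_funE !rmorph1.
by rewrite rmorphM !restr_funE !rmorphM.
Qed.

HB.instance Definition _ (t : {rmorphism L -> L}) :=
  GRing.isZmodMorphism.Build algC algC (restr_fun t) (restr_fun_zmod t).
HB.instance Definition _ (t : {rmorphism L -> L}) :=
  GRing.isMonoidMorphism.Build algC algC (restr_fun t) (restr_fun_monoid t).

Variables (K : fieldType) (i : {rmorphism K -> L}).

Lemma restr_bij (t : gal i) : bijective (restr_fun t).
Proof. exact: Bijective (algC_autK (restr_fun t)) (algC_invautK _). Qed.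

Lemma restr_fix (t : gal i) (x : rat) : restr_fun t (ratr x) = ratr x.
Proof. exact: fmorph_rat. Qed.

(* The restriction Gal(L/K) -> Gal(algC/Q) along j: restr t is the unique
   element such that j \o restr t = t \o j. *)
Definition restr (t : gal i) : galQ := Gal (restr_bij t) (restr_fix t).

Definition restr_cochain (F : curve) (c : cochainQ F) : cochain i F :=
  fun t => map_point j (c (restr t)).

End Restriction.

Variant place := InfinitePlace | FinitePlace (p : nat) of prime p.

Definition place_abs (v : place) (x : rat) : real :=
  match v with
  | InfinitePlace => `|ratr x|
  | FinitePlace p _ =>
      if x == 0 then 0
      else p%:R ^ ((logn p `|denq x|)%:Z - (logn p `|numq x|)%:Z)
  end.

(* A completion of Q at v: a complete valued field, containing Q as a dense
   subfield on which the absolute value is that of v.  It is unique up to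
   isometry: the field of p-adic numbers, or of real numbers. *)
Record completion (v : place) := Completion {
  completion_field :> fieldType;
  completion_abs : completion_field -> real;
  completion_abs_ge0 : forall x, 0 <= completion_abs x;
  completion_abs_eq0 : forall x, completion_abs x = 0 -> x = 0;
  completion_absM : forall x y,
    completion_abs (x * y) = completion_abs x * completion_abs y;
  completion_absD : forall x y,
    completion_abs (x + y) <= completion_abs x + completion_abs y;
  completion_abs_rat : forall x : rat, completion_abs (ratr x) = place_abs v x;
  completion_dense : forall (x : completion_field) (e : real), 0 < e ->
    exists q : rat, completion_abs (x - ratr q) < e;
  completion_complete : forall u : nat -> completion_field,
    (forall e : real, 0 < e -> exists N : nat, forall m n : nat,
       (N <= m)%N -> (N <= n)%N -> completion_abs (u m - u n) < e) ->
    exists l, forall e : real, 0 < e -> exists N : nat, forall n : nat,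
      (N <= n)%N -> completion_abs (u n - l) < e }.

Record alg_closure (K : fieldType) := AlgClosure {
  closure_field :> fieldType;
  closure_emb : {rmorphism K -> closure_field};
  closure_closed : GRing.closed_field_axiom closure_field;
  closure_algebraic : forall x, algebraicOver closure_emb x }.

(* The class of c is in the kernel of H^1(Q, F) -> H^1(Q_v, F).  Neither H^1
   nor the map depends, up to isomorphism, on the model K of Q_v, on its
   algebraic closure L or on the embedding j. *)
Definition locally_trivial (F : curve) (c : cochainQ F) (v : place) : Prop :=
  forall (K : completion v) (L : alg_closure K) (j : {rmorphism algC -> L}),
    coboundary (restr_cochain j (i := closure_emb L) c).

(* The cocycles whose class lies in Sha(F). *)
Definition sha_cocycle (F : curve) (c : cochainQ F) : Prop :=
  cocycle c /\ forall v : place, locally_trivial c v.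

Definition sha_2torsion_nontrivial (F : curve) : Prop :=
  exists c : cochainQ F,
    [/\ sha_cocycle c, coboundary (add_cochain c c) & ~ coboundary c].

Definition squarefree (d : nat) : Prop :=
  forall m : nat, (m ^ 2 %| d)%N -> m = 1%N.

(* Literals of nat_scope are kept as decimals, while those of ring_scope are
   unary; the next line prevents simpl from making the former unary too. *)
Arguments Nat.of_num_uint : simpl never.

Definition E : curve := Curve (- (708584%N)%:R) (- (1417172%N)%:R) 0.

Definition E' : curve := Curve (1417168%N)%:R (502096953744%N)%:R 0.

(* The conductor of E. *)
Definition N_E : nat := 2 ^ 6 * 3 * 19 * 29 * 643.

(* Main.v *)
From HB Require Import structures.
Require Import Defs.
From mathcomp Require Import all_boot all_order all_algebra all_field.
From mathcomp Require Import fingroup cyclic.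
From mathcomp Require Import boolp classical_sets cardinality reals Rstruct.
From mathcomp Require Import ring zify.

Set Implicit Arguments.
Unset Strict Implicit.
Unset Printing Implicit Defensive.

Import Order.TTheory GRing.Theory Num.Theory.
Local Open Scope ring_scope.

(* With m = 19 * 29 * 643 one has m + 1 = 2 * 3^11, and E_d is
   y^2 = x (x - e2) (x - e3) for e2 = - 2 d and e3 = 2 m d.  A nonzero rational
   delta gives the class in H^1(Q, E'_d) of the cocycle that sends s to (0, 0)
   or O according to whether s moves sqrt delta; it is killed by 2, and it is
   trivial over K exactly when the covering
   delta N^2 = (delta z^2 - e2) (delta z^2 - e3) has a point over K.

   Globally, when E_d(Q) is finite, doubling is injective, hence surjective, on
   the points all of whose x, x - e2, x - e3 are squares; therefore every
   rational point has x in {1, e2 e3, e2, e3} modulo squares, and delta outside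
   these four classes gives a nontrivial class.

   Locally, for delta a product of elements of {-1, 19, 643} and of primes
   dividing d, the covering is soluble as soon as one sign condition holds at
   2, at 3 and at each prime dividing d.  This is one condition fewer than there
   are generators, so linear algebra over F_2 yields a nontrivial delta. *)

(** * The fixed field of the absolute Galois group of Q *)

Lemma galQ_of_rmorph (nu : {rmorphism algC -> algC}) :
  {s : galQ | s =1 nu}.
Proof.
have fixQ (x : rat) : nu (ratr x) = ratr x by exact: fmorph_rat.
have nu_bij := Bijective (algC_autK nu) (algC_invautK nu).
by exists (@Defs.Gal _ _ (ratr : {rmorphism rat -> algC}) nu nu_bij fixQ).
Qed.

(** The number field generated by the conjugates of [x] is Galois over Q and its automorphisms
    extend to [algC], so [x] lies in the fixed field of a finite Galois group. *)
Lemma galQ_fixed_rat (x : algC) :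
  (forall s : galQ, s x = x) -> exists q : rat, x = ratr q.
Proof.
move=> fix_x.
have [p [Dp p_mon] _] := minCpolyP x.
have [r Dr] := closed_field_poly_normal (minCpoly x).
have /monicP lc1 := minCpoly_monic x; rewrite lc1 scale1r in Dr.
have [Qs [QsC [r1 Dr1 genQs]]] := num_field_exists r.
pose p1 : {poly Qs} := map_poly (in_alg Qs) p.
have Dp1 : p1 = \prod_(z <- r1) ('X - z%:P).
  apply: (map_poly_inj QsC).
  rewrite rmorph_prod /= /p1 -map_poly_comp.
  transitivity (minCpoly x).
    by rewrite Dp; apply: eq_map_poly => a /=; rewrite alg_num_field fmorph_rat.
  rewrite Dr -Dr1 big_map; apply: eq_bigr => z _.
  by rewrite map_polyXsubC.
have p1_1 : p1 \is a polyOver 1%VS.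
  by apply/polyOverP => i; rewrite coef_map /= rpredZ // mem1v.
have split1 : splittingFieldFor 1 p1 {:Qs}.
  by exists r1; rewrite ?Dp1 ?eqpxx.
have gal_t : SplittingField.axiom Qs by exists p1.
pose Mx := FieldExt_isSplittingField.Build _ Qs gal_t.
pose Qt : splittingFieldType rat := HB.pack Qs Mx.
have galt : galois 1 {:Qt}.
  apply/and3P; split.
  - exact: subvf.
  - apply/allP => z _; apply: pcharf0_separable.
    by move=> q; rewrite (pchar_lalg Qt) pchar_num.
  - by apply/splitting_normalField; [exact: subvf | exists p1].
have x_r : x \in r.
  by have := root_minCpoly x; rewrite Dr root_prod_XsubC.
have [x1 _ Dx1] : exists2 x1 : Qt, x1 \in r1 & x = QsC x1.
  by move: x_r; rewrite -Dr1 => /mapP.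
have : x1 \in fixedField 'Gal({:Qt} / 1)%g.
  apply/fixedFieldP => [|g _]; first exact: memvf.
  pose gR : {rmorphism Qs -> Qs} := (g : {rmorphism Qt -> Qt}).
  have [nu Dnu] := extend_algC_subfield_aut QsC gR.
  have [s Ds] := galQ_of_rmorph nu.
  apply: (fmorph_inj QsC); rewrite -Dx1.
  by have := Dnu x1; rewrite -Dx1 -Ds fix_x.
rewrite (galois_fixedField galt) => /vlineP [k Dk].
by exists k; rewrite Dx1 Dk /= alg_num_field fmorph_rat.
Qed.

(** * The classes attached to square roots *)

Definition full_torsion_curve (e2 e3 : rat) : curve :=
  Curve (- (e2 + e3)) (e2 * e3) 0.

(** The quotient of [full_torsion_curve e2 e3] by [(0, 0)]: the 2-isogeny from
    [y^2 = x^3 + a x^2 + b x] to [y^2 = x^3 - 2 a x^2 + (a^2 - 4 b) x]. *)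
Definition isogenous_curve (e2 e3 : rat) : curve :=
  Curve (2 * (e2 + e3)) ((e2 - e3) ^+ 2) 0.

Section CoveringSolubility.
Variables (K : fieldType) (f : {rmorphism rat -> K}).

Definition is_square (x : rat) : Prop := exists r : K, r ^+ 2 = f x.

(* The second alternative is an affine point of the 2-covering
   delta N^2 = (delta z^2 - e2) (delta z^2 - e3) of the isogenous curve; the
   first one makes its points at infinity rational. *)
Definition covering_soluble (e2 e3 delta : rat) : Prop :=
  is_square delta \/
  exists z N : K, f delta * N ^+ 2 =
    (f delta * z ^+ 2 - f e2) * (f delta * z ^+ 2 - f e3).

End CoveringSolubility.

Section TorsionCocycle.
Variables e2 e3 : rat.
Hypotheses (e2_neq0 : e2 != 0) (e3_neq0 : e3 != 0) (e23 : e2 != e3).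

Local Notation F' := (isogenous_curve e2 e3).

Definition zero_point (L : fieldType) : curve_point F' L :=
  @Point F' L None isT.

Lemma origin_on_curve (L : fieldType) : @on_curve F' L (Some (0, 0)).
Proof. by rewrite /on_curve /= !expr0n /= !mulr0 (ratr_int L 0) !addr0. Qed.

Definition origin (L : fieldType) : curve_point F' L :=
  Point (origin_on_curve L).

Lemma map_zero_point (L M : fieldType) (f : {rmorphism L -> M}) :
  map_point f (zero_point L) = zero_point M.
Proof. exact/val_inj. Qed.

Lemma map_origin (L M : fieldType) (f : {rmorphism L -> M}) :
  map_point f (origin L) = origin M.
Proof. by apply/val_inj; rewrite /= rmorph0. Qed.

Lemma add_zero_point (L : fieldType) (P : curve_point F' L) :
  add_point (zero_point L) P = P.
Proof. exact/val_inj. Qed.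

Lemma add_point_zero (L : fieldType) (P : curve_point F' L) :
  add_point P (zero_point L) = P.
Proof. by apply/val_inj; case: P => -[[x y]|]. Qed.

Lemma add_origin (L : fieldType) :
  add_point (origin L) (origin L) = zero_point L.
Proof. by apply/val_inj; rewrite /= eqxx /= oppr0 eqxx. Qed.

Lemma add_opp_point (L : fieldType) (P : curve_point F' L) :
  add_point P (opp_point P) = zero_point L.
Proof.
by apply/val_inj; case: P => -[[x y]|] //= _; rewrite eqxx /= opprK eqxx.
Qed.

Variables (delta : rat) (w : algC).
Hypotheses (delta_neq0 : delta != 0) (w2 : w ^+ 2 = ratr delta).

Definition torsion_cocycle : cochainQ F' :=
  fun s => if s w == w then zero_point algC else origin algC.

Lemma w_neq0 : w != 0.
Proof. by rewrite -sqrf_eq0 w2 fmorph_eq0. Qed.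

Lemma sqrt_aut (s : galQ) : s w = w \/ s w = - w.
Proof.
have : (s w) ^+ 2 == w ^+ 2 by rewrite -rmorphXn w2 fmorph_rat.
by rewrite eqf_sqr => /orP[] /eqP; [left | right].
Qed.

Lemma oppw_neq : (- w == w) = false.
Proof. by rewrite eqNr (negPf w_neq0). Qed.

Lemma torsion_cocycleP : cocycle torsion_cocycle.
Proof.
split=> [s | s t].
  exists [:: w] => t ts; rewrite /torsion_cocycle ts ?inE //.
rewrite /torsion_cocycle /=.
have [->|->] := sqrt_aut t; rewrite ?rmorphN /=;
  have [->|->] := sqrt_aut s; rewrite ?opprK ?eqxx ?oppw_neq;
  by rewrite ?map_zero_point ?map_origin ?add_zero_point ?add_point_zero ?add_origin.
Qed.

Lemma torsion_cocycle_double :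
  coboundary (add_cochain torsion_cocycle torsion_cocycle).
Proof.
exists (zero_point algC) => s; rewrite map_zero_point add_opp_point.
rewrite /add_cochain /torsion_cocycle.
by case: ifP; rewrite ?add_zero_point ?add_origin.
Qed.

(** If [P] trivializes the cocycle, automorphisms fixing [w] fix [P], and the others translate it by
    [(0, 0)], sending [X] to [b' / X] and [Y / X] to [- (Y / X)]. Hence, for irrational [w], both
    [Y / X] and [X - b' / X] are rational multiples of [w]. *)
Lemma torsion_cocycle_coboundary :
  coboundary torsion_cocycle -> covering_soluble idfun e2 e3 delta.
Proof.
case=> P cP.
have [sP | /existsNP[s1 /eqP s1w]] := pselect (forall s : galQ, s w = w).
  have [q Dq] := galQ_fixed_rat sP.
  left; exists q; apply: (fmorph_inj (ratr : {rmorphism rat -> algC})).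
  by rewrite rmorphXn /= -Dq w2.
have {s1 s1w} : exists2 s : galQ, s w = - w & s w != w.
  by exists s1 => //; have [/eqP|//] := sqrt_aut s1; rewrite (negPf s1w).
case=> s1 _ s1w.
case: P cP => -[[X Y]|] onP cP; last first.
  have := cP s1; rewrite /torsion_cocycle (negPf s1w) => /(congr1 val) //=.
have eqP0 := onP; move/eqP: eqP0; rewrite /= rmorph0 addr0 => eqP0.
set a' : algC := ratr (2 * (e2 + e3)) in eqP0.
set b' : algC := ratr ((e2 - e3) ^+ 2) in eqP0.
have fixed (s : galQ) : s w = w -> s X = X /\ s Y = Y.
  move=> sw; have := cP s; rewrite /torsion_cocycle sw eqxx => /(congr1 val) /=.
  have [sX|//] /= := eqVneq (s X) X.
  by rewrite opprK; have [sY|//] := eqVneq (s Y) Y.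
(* Otherwise [P = (0, 0)] is fixed by every automorphism, although [s1] moves [w]. *)
have X0 : X != 0.
  apply/eqP => X0; have Y0 : Y = 0.
    by apply/eqP; rewrite -sqrf_eq0 eqP0 X0; apply/eqP; ring.
  have := cP s1; rewrite /torsion_cocycle (negPf s1w) => /(congr1 val) /=.
  by rewrite X0 Y0 !rmorph0 !oppr0; do 2!case: eqP => //=.
have moved (s : galQ) : s w = - w -> s (Y / X) = - (Y / X) /\ s X = b' / X.
  move=> sw; have := cP s; rewrite /torsion_cocycle sw oppw_neq => /(congr1 val) /=.
  have sX0 : s X != 0 by rewrite fmorph_eq0.
  have sE : s Y ^+ 2 = s X ^+ 3 + a' * s X ^+ 2 + b' * s X.
    have := congr1 s eqP0; rewrite rmorphXn => ->.
    rewrite !rmorphD rmorphXn (rmorphM s a') rmorphXn (rmorphM s b') /=.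
    by rewrite /a' /b' !fmorph_rat.
  (* The line through [s P] and [- P] passes through the origin, so its slope is both [s Y / s X]
     and [- (Y / X)]. It is a tangent when [s X = X], since then [s Y = - Y]. *)
  rewrite fmorph_div -/a' -/b'.
  have [sX|sXX] /= := eqVneq (s X) X; last first.
    set lam := (- Y - s Y) / _ => -[x3 y3].
    have lamX : lam * (X - s X) = - Y - s Y.
      by rewrite /lam divfK // subr_eq0 eq_sym.
    move: x3 y3 => /esym x3; rewrite x3 subr0 => /esym/eqP.
    rewrite subr_eq0 => /eqP y3.
    have lX : lam * X = - Y.
      by have := lamX; rewrite mulrBr y3 => /eqP; rewrite subr_eq subrK => /eqP.
    have Dl : lam = - (Y / X) by rewrite -mulNr -lX mulfK.
    split; first by rewrite -y3 mulfK // -Dl.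
    have e : lam ^+ 2 * X = X ^+ 2 + a' * X + b'.
      apply: (mulIf X0).
      transitivity ((lam * X) ^+ 2); first by ring.
      by rewrite lX sqrrN eqP0; ring.
    apply: (mulIf X0); rewrite divfK //.
    have : lam ^+ 2 = a' + X + s X by apply/eqP; rewrite -subr_eq0 -x3; apply/eqP; ring.
    move=> e'; move: e; rewrite e' => e.
    have -> : s X * X = (a' + X + s X) * X - X ^+ 2 - a' * X by ring.
    by rewrite e; ring.
  rewrite opprK; have [//|sYY] := eqVneq (s Y) Y.
  set lam := _ / (2 * s Y) => -[/esym x3]; rewrite x3 subr0 => /esym/eqP.
  rewrite subr_eq0 => /eqP y3.
  have sYN : s Y = - Y.
    have : s Y ^+ 2 == Y ^+ 2 by rewrite sE eqP0 sX.
    by rewrite eqf_sqr (negPf sYY) => /eqP.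
  have sY0 : s Y != 0 by apply: contraNneq sYY => e; rewrite e -[Y]opprK -sYN e oppr0.
  split; first by rewrite sX sYN mulNr.
  apply: (mulIf X0); rewrite sX divfK //.
  have l2 : lam * (2 * s Y) = 3 * X ^+ 2 + 2 * a' * X + b'.
    by rewrite /lam divfK ?sX // mulf_neq0 // pnatr_eq0.
  have : 2 * s Y ^+ 2 = X * (3 * X ^+ 2 + 2 * a' * X + b').
    transitivity (2 * s Y * (lam * s X)); first by rewrite y3; ring.
    by rewrite -l2 sX; ring.
  rewrite sE sX => e; apply: (mulIf X0); apply/eqP; rewrite -subr_eq0.
  by apply/eqP; move/eqP: e; rewrite -subr_eq0 => /eqP e; rewrite -[RHS]oppr0 -e; ring.
pose u := Y / X; pose v := X - b' / X.
have fixu (s : galQ) : s (u / w) = u / w.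
  rewrite fmorph_div; have [sw|sw] := sqrt_aut s.
    by have [sX sY] := fixed s sw; rewrite /u fmorph_div sX sY sw.
  by have [-> _] := moved s sw; rewrite sw divrNN.
have fixv (s : galQ) : s (v / w) = v / w.
  have sb : s b' = b' by exact: fmorph_rat.
  rewrite fmorph_div /v rmorphB fmorph_div sb; have [sw|sw] := sqrt_aut s.
    by have [-> _] := fixed s sw; rewrite sw.
  have [_ ->] := moved s sw; rewrite sw -[in RHS]divrNN opprB invf_div.
  by congr (_ / _); congr (_ - _); rewrite mulrC divfK // fmorph_eq0 sqrf_eq0 subr_eq0.
have [q Dq] := galQ_fixed_rat fixu.
have [r Dr] := galQ_fixed_rat fixv.
(* With [z = u / (2 w)], the equation [u^2 = X + a' + b' / X] makes
   [(delta z^2 - e2) (delta z^2 - e3)] equal to [v^2 / 16], hence [N = v / (4 w)]. *)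
right; exists (q / 2), (r / 4).
apply: (fmorph_inj (ratr : {rmorphism rat -> algC})).
have ue : u = ratr q * w by rewrite -Dq divfK ?w_neq0.
have ve : v = ratr r * w by rewrite -Dr divfK ?w_neq0.
rewrite !(rmorphXn, rmorphM, rmorphB, fmorphV) /=. rewrite !ratr_nat -w2.
have u2 : w ^+ 2 * ratr q ^+ 2 = X + a' + b' / X.
  have -> : w ^+ 2 * ratr q ^+ 2 = u ^+ 2 by rewrite ue; ring.
  by rewrite /u expr_div_n eqP0; field.
have v2 : w ^+ 2 * ratr r ^+ 2 = (X - b' / X) ^+ 2 by rewrite -/v ve; ring.
have -> : w ^+ 2 * (ratr r / 4) ^+ 2 = (X - b' / X) ^+ 2 / 16 by rewrite -v2; field.
have -> : w ^+ 2 * (ratr q / 2) ^+ 2 = (X + a' + b' / X) / 4 by rewrite -u2; field.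
rewrite /a' /b' !(rmorphXn, rmorphM, rmorphB, rmorphD) /=.
by field.
Qed.

(** The converse construction: the trivializing point is [(X, u X)], where [X] and [X'] have product
    [a4 F'] and sum [u ^+ 2 - a2 F']. An automorphism moving [W] exchanges [X] and [X'] and negates
    [u], which is translation by [(0, 0)]. *)
Lemma torsion_cocycle_restr_coboundary (K L : fieldType)
    (f : {rmorphism rat -> K}) (i : {rmorphism K -> L})
    (j : {rmorphism algC -> L}) :
  covering_soluble f e2 e3 delta ->
  coboundary (restr_cochain j (i := i) torsion_cocycle).
Proof.
have fL q : i (f q) = ratr q by exact: (fmorph_eq_rat (i \o f)).
have jL q : j (ratr q) = ratr q by rewrite fmorph_rat.
have W2 : j w ^+ 2 = i (f delta) by rewrite -rmorphXn w2 jL fL.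
have W0 : j w != 0 by rewrite fmorph_eq0 w_neq0.
have char2 : (2 : L) != 0 by rewrite -(rmorph_nat j) fmorph_eq0 pnatr_eq0.
have cE (t : Defs.gal i) : restr_cochain j (i := i) torsion_cocycle t =
    if t (j w) == j w then zero_point L else origin L.
  rewrite /restr_cochain /torsion_cocycle -(restr_funE j t w) fmorph_eq /=.
  by case: ifP; rewrite ?map_zero_point ?map_origin.
have sqrt_t (t : Defs.gal i) : t (j w) = j w \/ t (j w) = - j w.
  have : (t (j w)) ^+ 2 == j w ^+ 2 by rewrite -rmorphXn W2 gal_fix.
  by rewrite eqf_sqr => /orP[] /eqP; [left | right].
case=> [[r r2]|[z [N zN]]].
  exists (zero_point L) => t; rewrite cE map_zero_point add_opp_point.
  have : i r ^+ 2 == j w ^+ 2 by rewrite -rmorphXn r2 W2.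
  rewrite eqf_sqr => /orP[] /eqP e.
    by rewrite -e gal_fix eqxx.
  by rewrite -[j w]opprK -e rmorphN gal_fix eqxx.
move: W0 W2 sqrt_t cE; set W := j w => W0 W2 sqrt_t cE.
pose X := 2 * i (f delta) * i z ^+ 2 - i (f e2) - i (f e3) + 2 * i N * W.
pose X' := 2 * i (f delta) * i z ^+ 2 - i (f e2) - i (f e3) - 2 * i N * W.
pose u := 2 * i z * W.
have zN' := congr1 i zN.
have {}zN' : W ^+ 2 * i N ^+ 2 =
    (W ^+ 2 * i z ^+ 2 - i (f e2)) * (W ^+ 2 * i z ^+ 2 - i (f e3)).
  by rewrite W2; move: zN'; rewrite !(rmorphXn, rmorphM, rmorphB) /=.
have a'E : ratr (2 * (e2 + e3)) = 2 * (i (f e2) + i (f e3)) :> L.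
  by rewrite -fL !(rmorphM, rmorphD) /= !rmorph1.
have b'E : ratr ((e2 - e3) ^+ 2) = (i (f e2) - i (f e3)) ^+ 2 :> L.
  by rewrite -fL !(rmorphXn, rmorphB).
have XX' : X * X' = ratr ((e2 - e3) ^+ 2).
  transitivity ((2 * i (f delta) * i z ^+ 2 - i (f e2) - i (f e3)) ^+ 2 -
     4 * (W ^+ 2 * i N ^+ 2)); first by rewrite /X /X'; ring.
  by rewrite zN' b'E W2; ring.
have u2 : u ^+ 2 = X + ratr (2 * (e2 + e3)) + X'.
  by rewrite /u /X /X' a'E -W2; ring.
have X0 : X != 0.
  apply: contra_neq e23 => X0; apply/eqP; rewrite -subr_eq0 -sqrf_eq0.
  by rewrite -(fmorph_eq0 (i \o f)) /= fL -XX' X0 mul0r.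
have onP : @on_curve F' L (Some (X, u * X)).
  apply/eqP; rewrite (ratr_int L 0) addr0 exprMn u2 -XX' /=; ring.
exists (Point onP) => t; rewrite cE; apply/val_inj.
have tX : t W = - W -> t X = X'.
  move=> tW; rewrite /X /X' !(rmorphD, rmorphN, rmorphM, rmorphXn) /= tW !gal_fix.
  by rewrite !rmorph1; ring.
have [tW|tW] := sqrt_t t.
  rewrite tW eqxx /=.
  have tXX : t X = X.
    by rewrite /X !(rmorphD, rmorphN, rmorphM, rmorphXn) /= tW !gal_fix !rmorph1.
  have tu : t u = u by rewrite /u !(rmorphM, rmorphD) /= tW !gal_fix !rmorph1.
  by rewrite rmorphM tXX tu eqxx opprK eqxx.
have tu : t u = - u.
  by rewrite /u !(rmorphM, rmorphD) /= tW !gal_fix !rmorph1 mulrN.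
have -> : (t W == W) = false.
  rewrite tW -subr_eq0 -opprD oppr_eq0 -mulr2n -mulr_natl.
  by rewrite mulf_eq0 (negPf W0) (negPf char2).
rewrite /= rmorphM (tX tW) tu; case: eqVneq => [e|ne] /=.
  have b0 : X ^+ 2 = ratr ((e2 - e3) ^+ 2) by rewrite -XX' e.
  (* If [u] were 0, then [x^2 + a2 x + a4], with the coefficients of [F'], would have a double root,
     while its discriminant is [16 e2 e3]. *)
  have u0 : u != 0.
    apply/eqP => u0; move: u2; rewrite u0 e expr0n /= => /esym u2.
    have : 2 * 2 * 2 * 2 * (i (f e2) * i (f e3)) = 0.
      transitivity (ratr (2 * (e2 + e3)) ^+ 2 - 4 * ratr ((e2 - e3) ^+ 2) : L).
        by rewrite a'E b'E; ring.
      rewrite -b0.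
      transitivity ((X + ratr (2 * (e2 + e3)) + X) * (ratr (2 * (e2 + e3)) - 2 * X)).
        by ring.
      by rewrite u2 mul0r.
    move/eqP; rewrite !mulf_eq0 (negPf char2) !fmorph_eq0.
    by rewrite (negPf e2_neq0) (negPf e3_neq0).
  have y0 : - u * X != 0 by rewrite mulf_neq0 // oppr_eq0.
  rewrite e; have -> : (- u * X == - - (u * X)) = false.
    rewrite opprK mulNr -subr_eq0 -opprD oppr_eq0 -mulr2n -mulr_natl.
    by apply/negbTE; rewrite mulf_neq0 // mulf_neq0.
  (* Here and in the chord case below, [t P] and [- P] lie on the line [y = - u x] through the
     origin. *)
  set lam := _ / _.
  have -> : lam = - u.
    apply: (mulIf (_ : 2 * (- u * X) != 0)); first by rewrite mulf_neq0.
    rewrite /lam divfK; last by rewrite mulf_neq0.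
    rewrite -[ratr (a4 F')]b0 -[ratr (a2 F')]/(ratr (2 * (e2 + e3))).
    transitivity (2 * X * (X + ratr (2 * (e2 + e3)) + X)); first by ring.
    by rewrite -{3}e -u2; ring.
  have x3 : (- u) ^+ 2 - ratr (a2 F') - X - X = 0.
    by rewrite -[ratr (a2 F')]/(ratr (2 * (e2 + e3))) sqrrN u2 e; ring.
  by rewrite /chord_coords /= x3; congr (Some (_, _)); ring.

set lam := _ / _.
have -> : lam = - u.
  have XX'0 : X - X' != 0 by rewrite subr_eq0 eq_sym.
  by apply: (mulIf XX'0); rewrite divfK //; ring.
have x3 : (- u) ^+ 2 - ratr (a2 F') - X' - X = 0.
  by rewrite -[ratr (a2 F')]/(ratr (2 * (e2 + e3))) sqrrN u2; ring.
rewrite /chord_coords /= x3; congr (Some (_, _)); ring.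
Qed.

End TorsionCocycle.

(** * Two-descent on the finite group of rational points *)

Section TwoDescent.
Variables e2 e3 : rat.
Hypothesis e23_lt0 : e2 * e3 < 0.
Hypothesis nsq2 : ~ is_square idfun (e2 * (e2 - e3)).
Hypothesis nsq3 : ~ is_square idfun (e3 * (e3 - e2)).

Let cubic (x : rat) := x * (x - e2) * (x - e3).

(** The criterion of complete 2-descent for [x] to be the abscissa of the double of a rational
    point. *)
Definition doubled (x : rat) : Prop :=
  [/\ is_square idfun x, is_square idfun (x - e2) & is_square idfun (x - e3)].

(** The duplication formula on [y^2 = cubic x]. *)
Definition double_abscissa (x : rat) : rat :=
  (x ^+ 2 - e2 * e3) ^+ 2 / (4 * cubic x).

Lemma doubled_cubic_neq0 x : doubled x -> cubic x != 0.
Proof.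
case=> -[r /= Dr] [s /= Ds] [t /= Dt]; apply/eqP => /eqP.
rewrite !mulf_eq0 -orbA => /or3P[/eqP x0|/eqP x2|/eqP x3].
- have : 0 <= (s * t) ^+ 2 by exact: sqr_ge0.
  by rewrite exprMn Ds Dt x0 !sub0r mulrNN leNgt e23_lt0.
- apply: nsq2; exists (r * t) => /=; rewrite exprMn Dr Dt.
  by move/eqP: x2; rewrite subr_eq0 => /eqP ->.
- apply: nsq3; exists (r * s) => /=; rewrite exprMn Dr Ds.
  by move/eqP: x3; rewrite subr_eq0 => /eqP ->.
Qed.

Lemma doubled_double_abscissa x y :
  y ^+ 2 = cubic x -> y != 0 -> doubled (double_abscissa x).
Proof.
move=> yx y0; rewrite /double_abscissa -yx.
split; [exists ((x ^+ 2 - e2 * e3) / (2 * y))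
       | exists ((x ^+ 2 - 2 * e2 * x + e2 * e3) / (2 * y))
       | exists ((x ^+ 2 - 2 * e3 * x + e2 * e3) / (2 * y))] => /=.
- by field.
- apply/eqP; rewrite -subr_eq0; apply/eqP.
  transitivity (e2 * (4 * y ^+ 2 - 4 * cubic x) / (4 * y ^+ 2));
    first by rewrite /cubic; field.
  by rewrite yx subrr mulr0 mul0r.
- apply/eqP; rewrite -subr_eq0; apply/eqP.
  transitivity (e3 * (4 * y ^+ 2 - 4 * cubic x) / (4 * y ^+ 2));
    first by rewrite /cubic; field.
  by rewrite yx subrr mulr0 mul0r.
Qed.

(* The cases say that the two points differ, up to sign, by O or by one of the
   three points of order 2. *)
Lemma double_abscissa_eq x x' : cubic x != 0 -> cubic x' != 0 ->
  double_abscissa x = double_abscissa x' ->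
  [\/ x = x', x * x' = e2 * e3,
      (x - e2) * (x' - e2) = e2 * (e2 - e3) |
      (x - e3) * (x' - e3) = e3 * (e3 - e2)].
Proof.
move=> c0 c0'.
have c4 : 4 * cubic x != 0 by exact: mulf_neq0.
have c4' : 4 * cubic x' != 0 by exact: mulf_neq0.
move=> /eqP; rewrite /double_abscissa eqr_div // => /eqP e.
have : 4 * (x - x') * (x * x' - e2 * e3) *
    ((x - e2) * (x' - e2) - e2 * (e2 - e3)) *
    ((x - e3) * (x' - e3) - e3 * (e3 - e2)) = 0.
  transitivity ((x ^+ 2 - e2 * e3) ^+ 2 * (4 * cubic x') -
                (x' ^+ 2 - e2 * e3) ^+ 2 * (4 * cubic x)).
    by rewrite /cubic; ring.
  by rewrite e subrr.
move/eqP; rewrite 4!mulf_eq0 pnatr_eq0 !subr_eq0 /= -!orbA.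
by case/or4P => /eqP; [constructor 1 | constructor 2 | constructor 3 | constructor 4].
Qed.

(** In the three exceptional cases of [double_abscissa_eq] the left side is a product of squares,
    while the right side is negative or one of the two excluded nonsquares. *)
Lemma double_abscissa_inj x x' : doubled x -> doubled x' ->
  double_abscissa x = double_abscissa x' -> x = x'.
Proof.
move=> dx dx'.
have := double_abscissa_eq (doubled_cubic_neq0 dx) (doubled_cubic_neq0 dx').
move: dx dx' => [[r /= <-] [s /= Ds] [t /= Dt]].
move=> [[r' /= <-] [s' /= Ds'] [t' /= Dt']] E /E.
case=> //.
- rewrite -exprMn => e; have := sqr_ge0 (r * r').
  by rewrite e leNgt e23_lt0.
- rewrite -Ds -Ds' -exprMn => e; by case: nsq2; exists (s * s').
- rewrite -Dt -Dt' -exprMn => e; by case: nsq3; exists (t * t').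
Qed.

(** By finiteness, doubling permutes the [doubled] abscissae, on which it is injective. So some [P']
    with square abscissa has the same double as [P] up to sign; the two points then differ, up to
    sign, by a 2-torsion point, which determines the class of [x]. *)
Lemma descent_image x y :
  finite_set (rational_points (full_torsion_curve e2 e3)) ->
  y ^+ 2 = cubic x -> x != 0 ->
  [\/ is_square idfun x, is_square idfun (x * (e2 * e3)),
      is_square idfun (x * e2) | is_square idfun (x * e3)].
Proof.
move=> fin_pts yx x0.
have [y0|y0] := eqVneq y 0.
  move: yx; rewrite y0 expr0n => /esym/eqP.
  rewrite !mulf_eq0 (negPf x0) !subr_eq0 /= => /orP[] /eqP ->.
    by constructor 3; exists e2; rewrite expr2.
  by constructor 4; exists e3; rewrite expr2.
pose abscissa (P : curve_point (full_torsion_curve e2 e3) rat) :=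
  if coords P is Some (a, _) then a else 0.
have fin_doubled : finite_set [set z : rat | doubled z]%classic.
  apply: sub_finite_set (finite_image abscissa fin_pts) => z dz.
  have [[r /= Dr] [s /= Ds] [t /= Dt]] := dz.
  have on_z : @on_curve (full_torsion_curve e2 e3) rat (Some (z, r * s * t)).
    apply/eqP => /=; rewrite !exprMn Dr Ds Dt.
    by rewrite -!(fmorph_eq_rat (idfun : {rmorphism rat -> rat})) /=; ring.
  by exists (Point on_z).
have /finite_seqP[s Ds] := fin_doubled.
have memS z : z \in undup s <-> doubled z.
  rewrite mem_undup; have /= := congr1 (fun A : set rat => A z) Ds.
  by move=> ->.
have img : {subset [seq double_abscissa z | z <- undup s] <= undup s}.
  move=> _ /mapP[z /memS dz ->]; apply/memS.
  have [[r /= Dr] [q /= Dq] [t /= Dt]] := dz.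
  have e : (r * q * t) ^+ 2 = cubic z by rewrite !exprMn Dr Dq Dt.
  apply: (doubled_double_abscissa e).
  by rewrite -sqrf_eq0 e doubled_cubic_neq0.
have uniq_img : uniq [seq double_abscissa z | z <- undup s].
  rewrite map_inj_in_uniq ?undup_uniq // => z z' /memS dz /memS dz'.
  exact: double_abscissa_inj.
have [|_ onto] := uniq_min_size uniq_img img; first by rewrite size_map.
have /memS : doubled (double_abscissa x) by exact: (doubled_double_abscissa yx y0).
rewrite -onto => /mapP[x' /memS dx' e].
have c0 : cubic x != 0 by rewrite -yx sqrf_eq0.
have c0' := doubled_cubic_neq0 dx'.
have [[r /= Dr] _ _] := dx'.
have [] := double_abscissa_eq c0 c0' e => E.
- by constructor 1; exists r; rewrite Dr E.
- by constructor 2; exists (x * r); rewrite exprMn /= Dr expr2 -mulrA E.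
(* As [x' = r ^+ 2], the relation [E] says [(x - e2) * r ^+ 2 = e2 * (x - e3)], so [(r * x * (x -
   e2)) ^+ 2 = x * e2 * cubic x]. The last case is the same with [e3]. *)
- constructor 3.
  exists (r * x * (x - e2) / y); rewrite /= exprMn exprVn yx -Dr in E *.
  rewrite !exprMn; apply: (mulIf c0); rewrite divfK // /cubic.
  transitivity (x ^+ 2 * (x - e2) * ((x - e2) * r ^+ 2)); first by ring.
  have -> : (x - e2) * r ^+ 2 = (x - e2) * (r ^+ 2 - e2) + (x - e2) * e2 by ring.
  by rewrite E; ring.
- constructor 4.
  exists (r * x * (x - e3) / y); rewrite /= exprMn exprVn yx -Dr in E *.
  rewrite !exprMn; apply: (mulIf c0); rewrite divfK // /cubic.
  transitivity (x ^+ 2 * (x - e3) * ((x - e3) * r ^+ 2)); first by ring.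
  have -> : (x - e3) * r ^+ 2 = (x - e3) * (r ^+ 2 - e3) + (x - e3) * e3 by ring.
  by rewrite E; ring.
Qed.

End TwoDescent.

(** * Square roots in the completions of Q *)

Section Completion.
Variables (v : place) (K : completion v).

Local Notation abs := (@completion_abs v K).

Lemma place_abs_eq0 (x : rat) : place_abs v x = 0 -> x = 0.
Proof.
case: v => [|p p_pr] /=.
  by move/normr0P; rewrite fmorph_eq0 => /eqP.
case: eqVneq => // _ /eqP; rewrite expfz_eq0 pnatr_eq0.
by rewrite -[p == 0]negbK -lt0n prime_gt0 // andbF.
Qed.

Lemma place_abs0 : place_abs v 0 = 0.
Proof. by case: v => [|p p_pr] /=; rewrite ?eqxx // rmorph0 normr0. Qed.

Lemma ratr_completion_eq0 (x : rat) : ratr x = 0 :> K -> x = 0.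
Proof.
move=> x0; apply: place_abs_eq0; rewrite -(completion_abs_rat K) x0.
by rewrite -[RHS]place_abs0 -(completion_abs_rat K) (ratr_int K 0).
Qed.

Lemma intr_completion_eq0 (n : int) : n%:~R = 0 :> K -> n = 0.
Proof.
by rewrite -ratr_int => /ratr_completion_eq0/eqP; rewrite intr_eq0 => /eqP.
Qed.

Lemma denq_completion_neq0 (x : rat) : (denq x)%:~R != 0 :> K.
Proof. by apply/eqP => /intr_completion_eq0/eqP; rewrite denq_eq0. Qed.

Lemma ratr_completion_frac (a b : int) : b != 0 ->
  ratr (a%:~R / b%:~R) = a%:~R / b%:~R :> K.
Proof.
move=> b0; set x := a%:~R / b%:~R.
have b0' : b%:~R != 0 :> K by apply: contra_neq b0 => /intr_completion_eq0.
apply/eqP; rewrite eqr_div ?denq_completion_neq0 // -!intrM; apply/eqP.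
congr (_%:~R); apply: (@intr_inj rat); rewrite !intrM.
apply/eqP; rewrite -eqr_div ?intr_eq0 ?denq_eq0 // divq_num_den.
by [].
Qed.

(** The absolute value forces [K] to have characteristic 0, which makes [ratr] a ring morphism; this
    name carries that structure. *)
Definition completion_emb (x : rat) : K := ratr x.

Lemma completion_emb_zmod : zmod_morphism completion_emb.
Proof.
move=> x y; rewrite /completion_emb -{1}[x]divq_num_den -{1}[y]divq_num_den.
have [dx dy] := (denq_completion_neq0 x, denq_completion_neq0 y).
rewrite -mulNr addf_div ?intr_eq0 ?denq_eq0 // -rmorphN -!intrM -intrD.
rewrite ratr_completion_frac ?mulf_neq0 ?denq_eq0 // /ratr.
by rewrite intrD !intrM rmorphN /=; field; rewrite dx dy.
Qed.

Lemma completion_emb_monoid : monoid_morphism completion_emb.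
Proof.
split=> [|x y]; first exact: (ratr_int K 1).
rewrite /completion_emb -{1}[x]divq_num_den -{1}[y]divq_num_den.
rewrite mulf_div -!intrM ratr_completion_frac ?mulf_neq0 ?denq_eq0 //.
by rewrite /ratr !intrM mulf_div.
Qed.

HB.instance Definition _ :=
  GRing.isZmodMorphism.Build rat K completion_emb completion_emb_zmod.
HB.instance Definition _ :=
  GRing.isMonoidMorphism.Build rat K completion_emb completion_emb_monoid.

Lemma abs_completion_emb (x : rat) : abs (completion_emb x) = place_abs v x.
Proof. exact: completion_abs_rat. Qed.

Lemma completion_abs1 : abs 1 = 1.
Proof.
have a0 : abs 1 != 0.
  by apply/eqP => /completion_abs_eq0/eqP; rewrite oner_eq0.
by apply: (mulfI a0); rewrite -completion_absM !mulr1.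
Qed.

Lemma completion_absN (x : K) : abs (- x) = abs x.
Proof.
rewrite -mulN1r completion_absM.
have : abs (-1) ^+ 2 == 1.
  by rewrite expr2 -completion_absM mulrNN mul1r completion_abs1.
rewrite sqrf_eq1 => /orP[] /eqP e; first by rewrite e mul1r.
by have := completion_abs_ge0 (-1 : K); rewrite e ler0N1.
Qed.

Lemma completion_absB (x y : K) : abs (x - y) <= abs x + abs y.
Proof. by rewrite -(completion_absN y) completion_absD. Qed.

(** The limit of [u] is a square root of [q] by continuity of squaring. The explicit rates suit real
    and p-adic approximations alike. *)
Lemma is_square_completion (q : rat) (u : nat -> rat) :
  (forall n, place_abs v (u n ^+ 2 - q) <= n.+1%:R^-1) ->
  (forall N m n, (N <= m)%N -> (N <= n)%N ->
     place_abs v (u m - u n) <= 2 / N.+1%:R) ->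
  is_square completion_emb q.
Proof.
move=> sq_u cauchy_u.
have small (e : real) : 0 < e -> exists N : nat, forall n, (N <= n)%N -> n.+1%:R^-1 < e.
  move=> e0; exists (Num.truncn e^-1) => n Nn.
  rewrite invf_plt ?posrE ?ltr0n //.
  apply: lt_le_trans (truncnS_gt _) _.
  by rewrite ler_nat ltnS.
have [|l Dl] := @completion_complete v K (fun n => completion_emb (u n)).
  move=> e e0; have [|N HN] := small (e / 2); first by rewrite divr_gt0.
  exists N => m n Nm Nn; rewrite -rmorphB abs_completion_emb.
  apply: le_lt_trans (cauchy_u N m n Nm Nn) _.
  by rewrite mulrC -ltr_pdivlMr // HN.
exists l; apply/eqP; rewrite -subr_eq0; apply/eqP/completion_abs_eq0.
apply/eqP; rewrite eq_le completion_abs_ge0 andbT leNgt; apply/negP => e0.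
set e := abs _ in e0.
(* Bounds [abs (un + l)] once [abs (un - l) < 1]. *)
pose C := 2 * abs l + 1.
have C0 : 0 < C by rewrite ltr_wpDl // mulr_ge0 // completion_abs_ge0.
have [|N1 HN1] := Dl (Num.min 1 (e / (2 * C))).
  by rewrite lt_min ltr01 divr_gt0 // mulr_gt0.
have [|N2 HN2] := small (e / 2); first by rewrite divr_gt0.
set n := maxn N1 N2.
have := HN1 n (leq_maxl _ _); rewrite lt_min => /andP[u1 u2].
have e3 := le_lt_trans (sq_u n) (HN2 n (leq_maxr _ _)).
set un := completion_emb (u n) in u1 u2.
have : e < e; last by rewrite ltxx.
have De : e = abs ((un ^+ 2 - completion_emb q) - (un - l) * ((un - l) + (l + l))).
  by congr abs; ring.
rewrite {1}De; apply: le_lt_trans (completion_absB _ _) _.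
rewrite completion_absM -rmorphXn -rmorphB abs_completion_emb.
rewrite [X in _ < X](splitr e); apply: ltr_leD => //.
have bC : abs (un - l + (l + l)) <= C.
  apply: le_trans (completion_absD _ _) _; rewrite addrC; apply: lerD (ltW u1).
  by apply: le_trans (completion_absD _ _) _; rewrite mulr_natl mulr2n.
apply: le_trans (ler_pM (completion_abs_ge0 _) (completion_abs_ge0 _) (ltW u2) bC) _.
by rewrite invfM mulrA divfK // gt_eqF.
Qed.

End Completion.

Lemma is_square_real (K : completion InfinitePlace) (q : rat) :
  0 < q -> is_square (completion_emb K) q.
Proof.
move=> q0; set s : real := Num.sqrt (ratr q).
have s2 : s ^+ 2 = ratr q by rewrite sqr_sqrtr // ler0q ltW.
have s0 : 0 <= s by exact: sqrtr_ge0.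
(* An error of [1 / (C (n + 1))] in the root costs at most [1 / (n + 1)] in its square. *)
pose C := 2 * s + 1.
have C1 : 1 <= C by rewrite lerDr mulr_ge0.
have approx (n : nat) : exists r : rat, `|ratr r - s| <= (C * n.+1%:R)^-1.
  have e0 : 0 < (C * n.+1%:R)^-1.
    by rewrite invr_gt0 mulr_gt0 ?ltr0n // (lt_le_trans ltr01).
  move: (_^-1) e0 => e e0.
  have lt_s : s - e < s + e by rewrite ltrD2l gtrN.
  have [r] := rat_in_itvoo lt_s; rewrite in_itv /= => /andP[r1 r2].
  by exists r; rewrite ler_norml lerBrDr lerBlDr [- e + s]addrC [e + s]addrC !ltW.
pose u n := sval (cid (approx n)).
have Du n : `|ratr (u n) - s| <= (C * n.+1%:R)^-1 := svalP (cid (approx n)).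
have Du' n : `|ratr (u n) - s| <= n.+1%:R^-1.
  apply: le_trans (Du n) _; rewrite invfM ler_piMl ?invr_ge0 //.
  by rewrite invf_le1 // (lt_le_trans ltr01).
apply: (@is_square_completion _ K q u) => [n|N m n Nm Nn] /=.
  rewrite rmorphB rmorphXn /= -s2.
  have -> : ratr (u n) ^+ 2 - s ^+ 2 =
      (ratr (u n) - s) * ((ratr (u n) - s) + (s + s)) by ring.
  rewrite normrM; have bC : `|ratr (u n) - s + (s + s)| <= C.
    apply: le_trans (ler_normD _ _) _; rewrite (ger0_norm (addr_ge0 s0 s0)) /C.
    rewrite addrC mulr_natl mulr2n lerD2l; apply: le_trans (Du' n) _.
    by rewrite invf_le1 ?ltr0n // ler1n.
  apply: le_trans (ler_pM (normr_ge0 _) (normr_ge0 _) (Du n) bC) _.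
  by rewrite invfM mulrAC mulVf ?mul1r // gt_eqF // (lt_le_trans ltr01).
rewrite rmorphB /= (_ : _ - _ = (ratr (u m) - s) - (ratr (u n) - s)); last by ring.
apply: le_trans (ler_normB _ _) _; rewrite mulrDl mul1r.
have mono k : (N <= k)%N -> `|ratr (u k) - s| <= N.+1%:R^-1.
  move=> Nk; apply: le_trans (Du' k) _.
  by rewrite lef_pV2 ?posrE ?ltr0n // ler_nat.
by rewrite lerD ?mono.
Qed.

Section FinitePlace.
Variables (p : nat) (p_pr : prime p) (K : completion (FinitePlace p_pr)).

Lemma place_abs_int_le (z : int) (n : nat) :
  (p%:Z ^+ n %| z)%Z -> place_abs (FinitePlace p_pr) z%:~R <= n.+1%:R^-1.
Proof.
rewrite /= intr_eq0 numq_int denq_int logn1 sub0r.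
case: eqVneq => [->|z0 pz]; first by rewrite invr_ge0.
have p0 := prime_gt0 p_pr.
rewrite -exprnN lef_pV2 ?posrE ?exprn_gt0 ?ltr0n //.
rewrite -natrX ler_nat.
have : (n <= logn p `|z|)%N by move: pz; rewrite dvdzE abszX pfactor_dvdn ?absz_gt0.
(* The inequality [k < p ^ k] turns p-adic divisibility into the rate [1 / (n + 1)]. *)
move=> nl; apply: leq_trans (leq_ltn_trans nl (ltn_expl _ (prime_gt1 p_pr))) _.
by [].
Qed.

Lemma is_square_approx (q : int) (u : nat -> int) :
  (forall n, (p%:Z ^+ n %| u n ^+ 2 - q)%Z) ->
  (forall n, (p%:Z ^+ n %| u n.+1 - u n)%Z) ->
  is_square (completion_emb K) q%:~R.
Proof.
move=> sq_u step_u.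
apply: (@is_square_completion _ K _ (fun n => (u n)%:~R)) => [n|N m n Nm Nn].
  by rewrite -rmorphXn -rmorphB place_abs_int_le.
have near_uN k : (N <= k)%N -> (p%:Z ^+ N %| u k - u N)%Z.
  elim: k => [|k IHk]; first by rewrite leqn0 => /eqP ->; rewrite subrr dvdz0.
  rewrite leq_eqVlt => /orP[/eqP ->|Nk]; first by rewrite subrr dvdz0.
  rewrite -(subrKA (u k)) rpredD ?IHk //.
  by apply: dvdz_trans (step_u k); rewrite dvdz_exp2l.
rewrite -rmorphB; apply: le_trans (place_abs_int_le (_ : (p%:Z ^+ N %| _)%Z)) _.
  by rewrite -(subrKA (u N)) rpredD ?near_uN // -opprB rpredN near_uN.
by rewrite ler_peMl ?invr_ge0 // ler1n.
Qed.

(** Newton iteration with a fixed inverse [b] of [2 s] modulo [p] in place of that of [2 u_n]: each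
    step gains one power of [p], and [u_n] stays congruent to [s]. *)
Lemma is_square_hensel_odd (q s : int) : odd p ->
  ~~ (p%:Z %| s)%Z -> (p%:Z %| s ^+ 2 - q)%Z -> is_square (completion_emb K) q%:~R.
Proof.
move=> p_odd ps psq.
have co : coprimez p%:Z (2 * s).
  rewrite coprimezMr; apply/andP; split.
    by rewrite coprimezE /= coprimen2.
  by rewrite coprimezE prime_coprime.
have [[a b] /= ab] := coprimezP _ _ co.
pose newton (t : int) := t - (t ^+ 2 - q) * b.
pose u n := iter n newton s.
have inv n : (p%:Z ^+ n.+1 %| u n ^+ 2 - q)%Z /\ (p%:Z %| u n - s)%Z.
  elim: n => [|n [IH1 IH2]]; first by rewrite /u /= subrr dvdz0.
  have IH1' : (p%:Z %| u n ^+ 2 - q)%Z.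
    by apply: dvdz_trans IH1; rewrite exprS dvdz_mulr.
  rewrite /u iterS -/(u n) /newton; split; last first.
    rewrite [X in (_ %| X)%Z](_ : _ = (u n - s) - (u n ^+ 2 - q) * b); last by ring.
    by rewrite rpredB ?dvdz_mulr.
  rewrite [X in (_ %| X)%Z](_ : _ = (u n ^+ 2 - q) *
    (1 - 2 * u n * b + (u n ^+ 2 - q) * b ^+ 2)); last by ring.
  rewrite [p%:Z ^+ n.+2]exprSr dvdz_mul // rpredD ?dvdz_mulr //.
  have -> : 1 - 2 * u n * b = a * p%:Z - (u n - s) * (2 * b).
    by transitivity (a * p%:Z + b * (2 * s) - 2 * u n * b); [rewrite ab | ring].
  by apply: rpredB; [exact: dvdz_mull | exact: dvdz_mulr].
apply: (@is_square_approx _ u) => n.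
  by have [h _] := inv n; apply: dvdz_trans h; rewrite dvdz_exp2l.
have [h _] := inv n; rewrite /u iterS -/(u n) /newton addrC addKr rpredN.
by apply: dvdz_mulr; apply: dvdz_trans h; rewrite dvdz_exp2l.
Qed.

(** Newton iteration from 1, dividing by 2 instead of [2 t] as [t] stays odd. The congruence modulo
    8 starts the invariant at exponent 3, and each step gains one power of 2. *)
Lemma is_square_hensel2 (q : int) : p = 2 ->
  (8 %| q - 1)%Z -> is_square (completion_emb K) q%:~R.
Proof.
move=> p2 q8.
pose newton (t : int) := t - divz (t ^+ 2 - q) 2.
pose u n := iter n newton 1.
have inv n : (2 ^+ n.+3 %| u n ^+ 2 - q)%Z /\ (2 %| u n - 1)%Z.
  elim: n => [|n [IH1 IH2]].
    rewrite /u /= subrr dvdz0 expr1n -opprB rpredN; split => //.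
  have [c Dc] := dvdzP IH1.
  have Dn : newton (u n) = u n - c * 2 ^+ n.+2.
    by rewrite /newton Dc exprSr mulrA mulzK.
  have [k Dk] := dvdzP IH2.
  rewrite /u iterS -/(u n) Dn; split.
    apply/dvdzP; exists (- c * k + c ^+ 2 * 2 ^+ n).
    transitivity ((u n ^+ 2 - q) - c * 2 ^+ n.+3 * (u n - 1 + 1)
                  + c ^+ 2 * 2 ^+ n.+2 * 2 ^+ n.+2); first by rewrite !exprS; ring.
    by rewrite Dk Dc !exprS; ring.
  rewrite [X in (_ %| X)%Z](_ : _ = (u n - 1) - c * 2 ^+ n.+2); last by ring.
  by rewrite rpredB // exprS dvdz_mull // dvdz_mulr.
apply: (@is_square_approx _ u) => n; rewrite p2; have [h _] := inv n.
  by apply: dvdz_trans h; rewrite dvdz_exp2l // !leqW.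
rewrite /u iterS -/(u n) /newton addrC addKr rpredN.
have [c ->] := dvdzP h; rewrite exprSr mulrA mulzK // dvdz_mull // dvdz_exp2l //.
by rewrite !leqW.
Qed.

End FinitePlace.

(** * Squares in finite fields *)

Section FiniteField.
Variable F : finFieldType.

Definition nonsquare (x : F) : bool := [forall y : F, y ^+ 2 != x].

Lemma nonsquareP x : reflect (exists y : F, y ^+ 2 = x) (~~ nonsquare x).
Proof.
rewrite negb_forall; apply: (iffP existsP) => -[y].
  by rewrite negbK => /eqP; exists y.
by move=> e; exists y; rewrite negbK e.
Qed.

Lemma nonsquare_neq0 x : nonsquare x -> x != 0.
Proof. by move/forallP/(_ 0); rewrite expr0n eq_sym. Qed.

(** The unit group is cyclic and a nonsquare is an odd power of a generator, so a product of two
    nonsquares is an even power. *)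
Lemma nonsquareM x y : x != 0 -> y != 0 ->
  nonsquare (x * y) = nonsquare x (+) nonsquare y.
Proof.
move=> x0 y0.
have sqM (a b : F) : ~~ nonsquare a -> ~~ nonsquare b -> ~~ nonsquare (a * b).
  move=> /nonsquareP[s <-] /nonsquareP[t <-].
  by apply/nonsquareP; exists (s * t); rewrite exprMn.
have sqV (a : F) : ~~ nonsquare a -> ~~ nonsquare a^-1.
  by move=> /nonsquareP[s <-]; apply/nonsquareP; exists s^-1; rewrite exprVn.
have [nx|sx] := boolP (nonsquare x); have [ny|sy] := boolP (nonsquare y) => /=.
- have /cyclicP[g Dg] := field_unit_group_cyclic [set: {unit F}]%G.
  have gP (a : F) : a != 0 -> exists k, a = val g ^+ k.
    move=> a0; have ua : a \is a GRing.unit by rewrite unitfE.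
    have : FinRing.unit F ua \in <[g]>%g by rewrite -Dg inE.
    by case/cycleP => k /(congr1 val); rewrite FinRing.val_unitX /=; exists k.
  have [i Di] := gP x x0; have [j Dj] := gP y y0.
  have oddk (k : nat) : nonsquare (val g ^+ k) -> odd k.
    apply: contraTT => ek; apply/nonsquareP; exists (val g ^+ k./2).
    by rewrite -exprM muln2 even_halfK.
  rewrite Di in nx; rewrite Dj in ny.
  apply/negbTE/nonsquareP; exists (val g ^+ (i + j)./2).
  by rewrite -exprM muln2 even_halfK ?oddD ?oddk // exprD -Di -Dj.
- apply: contraTT (nx) => h; rewrite -(mulfK y0 x).
  by apply: sqM => //; apply: sqV.
- apply: contraTT (ny) => h; rewrite -(mulKf x0 y).
  by apply: sqM => //; apply: sqV.
- by apply/negbTE/sqM.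
Qed.

(* The Moebius map z |-> (z - a) / (z - b) would otherwise embed the set of
   nonsquares into the set of squares different from 0 and 1. *)
Lemma nonsquare_pair (a b n : F) : a != b -> nonsquare n ->
  exists2 z, nonsquare z & nonsquare ((z - a) * (z - b)) || ((z - a) * (z - b) == 0).
Proof.
move=> ab nn; apply/exists_inP; apply: contraT; rewrite negb_exists_in => /forall_inP h.
pose N := [set z | nonsquare z]; pose S := [set z : F | ~~ nonsquare z & z != 0].
have n0 := nonsquare_neq0 nn.
(* Multiplication by the nonsquare [n] gives the inequality that the Moebius map will contradict. *)
have le1 : (#|S| <= #|N|)%N.
  rewrite -(card_imset S (mulfI n0)); apply/subset_leq_card/fintype.subsetP.
  move=> _ /imsetP[s sS ->]; move: sS; rewrite inE => /andP[ss s0].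
  by rewrite inE nonsquareM // nn (negPf ss).
have S1 : 1 \in S.
  by rewrite inE oner_eq0 andbT; apply/nonsquareP; exists 1; rewrite expr1n.
have hz z : z \in N -> z - b != 0 /\ ~~ nonsquare ((z - a) * (z - b)) /\ z - a != 0.
  rewrite inE => /h; rewrite negb_or mulf_eq0 negb_or => /andP[h1 /andP[h2 h3]].
  by [].
pose m (z : F) := (z - a) / (z - b).
have le2 : (#|N| <= #|S :\ 1%R|)%N.
  rewrite -(card_in_imset (_ : {in N &, injective m})).
    apply/subset_leq_card/fintype.subsetP => _ /imsetP[z zN ->].
    have [zb [sq za]] := hz z zN.
    rewrite !inE /m mulf_neq0 ?invr_eq0 // andbT; apply/andP; split.
      rewrite -subr_eq0 (_ : _ - 1 = (b - a) / (z - b)); last by field.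
      by rewrite mulf_neq0 ?invr_eq0 // subr_eq0 eq_sym.
    move/nonsquareP: sq => [t Dt]; apply/nonsquareP; exists (t / (z - b)).
    by rewrite expr_div_n Dt; field.
  move=> z z' zN zN'; have [zb _] := hz z zN; have [zb' _] := hz z' zN'.
  move/eqP; rewrite /m eqr_div // => /eqP e.
  have : (z - z') * (a - b) = 0.
    by transitivity ((z - a) * (z' - b) - (z' - a) * (z - b)); [ring | rewrite e subrr].
  by move/eqP; rewrite mulf_eq0 !subr_eq0 (negPf ab) orbF => /eqP.
by move: (leq_trans le1 le2); rewrite (cardsD1 1 S) S1 add1n ltnn.
Qed.

End FiniteField.

(** * Local solubility of the coverings *)

Lemma is_square0 (K : fieldType) (f : {rmorphism rat -> K}) : is_square f 0.
Proof. by exists 0; rewrite rmorph0 expr0n. Qed.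

Lemma is_square_eqM (K : fieldType) (f : {rmorphism rat -> K}) (x t y : rat) :
  y = x * t ^+ 2 -> is_square f x -> is_square f y.
Proof.
by move=> -> [r Dr]; exists (r * f t); rewrite exprMn Dr rmorphM rmorphXn.
Qed.

(** Here [x] stands for [delta z^2], so that local points can be sought at rational abscissae. The
    abscissae 0, [e2] and [e3] are allowed: they make one of the two squares 0. *)
Lemma covering_soluble_at (K : fieldType) (f : {rmorphism rat -> K})
    (e2 e3 delta x : rat) : delta != 0 ->
  is_square f (delta * x) -> is_square f (delta * (x - e2) * (x - e3)) ->
  covering_soluble f e2 e3 delta.
Proof.
move=> d0 [r Dr] [s Ds]; right; exists (r / f delta), (s / f delta).
have fd0 : f delta != 0 by rewrite fmorph_eq0.
have -> : f delta * (r / f delta) ^+ 2 = f x.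
  by rewrite expr_div_n Dr rmorphM /=; field.
rewrite expr_div_n Ds !rmorphM !rmorphB /=; field.
by [].
Qed.

Section LocalSolubility.
Variables (p : nat) (p_pr : prime p) (K : completion (FinitePlace p_pr)).

Local Notation res x := (x%:~R : 'F_p).
Local Notation f := (completion_emb K).

Lemma intr_Fp_eq0 (x : int) : (res x == 0) = (p%:Z %| x)%Z.
Proof.
have pos (n : nat) : (res n == 0) = (p %| n)%N.
  by rewrite -pmulrn (dvdn_pcharf (pchar_Fp p_pr)).
case: x => n; first by rewrite pos dvdzE.
by rewrite NegzE rmorphN /= oppr_eq0 pos dvdzE abszN.
Qed.

Lemma is_square_res (x : int) : odd p ->
  res x != 0 -> ~~ nonsquare (res x) -> is_square f x%:~R.
Proof.
move=> p_odd x0 /nonsquareP[y Dy].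
pose s : int := (nat_of_ord y)%:Z.
have Ds : res s = y by exact: natr_Zp.
apply: (@is_square_hensel_odd _ _ _ _ s) => //.
  by rewrite -intr_Fp_eq0 Ds -sqrf_eq0 Dy.
by rewrite -intr_Fp_eq0 intrB rmorphXn /= Ds Dy subrr.
Qed.

Variables d m delta : int.
Hypotheses (p_odd : odd p) (delta_neq0 : delta != 0).

Local Notation soluble :=
  (covering_soluble f (- (2 * d))%:~R (2 * m * d)%:~R delta%:~R).

Let ratD_neq0 : delta%:~R != 0 :> rat. Proof. by rewrite intr_eq0. Qed.

Lemma intr2_Fp_neq0 : res 2 != 0.
Proof.
rewrite intr_Fp_eq0 dvdzE /= gtnNdvd //.
by have := odd_gt2 p_odd (prime_gt1 p_pr).
Qed.

Let two_neq0 := intr2_Fp_neq0.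

Lemma covering_soluble_good :
  res delta != 0 -> res d != 0 -> res m != 0 -> res (m + 1) != 0 -> soluble.
Proof.
move=> D0 d0 m0 m1.
have [nD|sD] := boolP (nonsquare (res delta)); last first.
  by left; apply: is_square_res.
have ab : res (- (2 * d)) != res (2 * m * d).
  rewrite -subr_eq0 -rmorphB /= (_ : _ - _ = - (2 * d * (m + 1))); last by ring.
  by rewrite rmorphN /= oppr_eq0 !rmorphM !mulf_neq0.
have [z nz] := nonsquare_pair ab nD.
pose x : int := (nat_of_ord z)%:Z.
have Dx : res x = z by exact: natr_Zp.
rewrite -Dx -!rmorphB /=; set a := - (2 * d); set b := 2 * m * d.
have sq (y : int) : res y = z -> is_square f (delta%:~R * y%:~R).
  move=> yz; rewrite -intrM; apply: is_square_res => //.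
    by rewrite intrM mulf_neq0 // yz nonsquare_neq0.
  by rewrite intrM yz nonsquareM ?nonsquare_neq0 // nD nz.
case/orP => [nab|].
  apply: (@covering_soluble_at _ _ _ _ _ x%:~R) => //; first exact: sq.
  rewrite -!rmorphB -!rmorphM /=; apply: is_square_res => //.
    by rewrite -mulrA intrM mulf_neq0 // rmorphM nonsquare_neq0.
  by rewrite -mulrA intrM nonsquareM // ?nD rmorphM /= ?nab // nonsquare_neq0.
(* When [z] is a root modulo [p], the exact root [a] or [b] replaces the lift [x], and the second
   square is 0. *)
rewrite mulf_eq0 -/a -/b => /orP[] h.
  apply: (@covering_soluble_at _ _ _ _ _ a%:~R) => //.
    by apply: sq; apply/eqP; rewrite -Dx eq_sym -subr_eq0 -rmorphB.
  by rewrite subrr mulr0 mul0r; exact: is_square0.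
apply: (@covering_soluble_at _ _ _ _ _ b%:~R) => //.
  by apply: sq; apply/eqP; rewrite -Dx eq_sym -subr_eq0 -rmorphB.
by rewrite subrr mulr0; exact: is_square0.
Qed.

(** The abscissa [e2 = -2 d] works: [delta * e2] is [p ^+ 2] times [- (2 * delta1 * d1)]. *)
Lemma covering_soluble_twist_prime (delta1 d1 : int) :
  delta = p%:Z * delta1 -> d = p%:Z * d1 ->
  res delta1 != 0 -> res d1 != 0 -> ~~ nonsquare (res (- (2 * delta1 * d1))) ->
  soluble.
Proof.
move=> D1 D2 D10 d10 sq.
apply: (@covering_soluble_at _ _ _ _ _ (- (2 * d))%:~R) => //; last first.
  by rewrite subrr mulr0 mul0r; exact: is_square0.
apply: (@is_square_eqM _ _ (- (2 * delta1 * d1))%:~R p%:R).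
  by rewrite D1 D2 !(intrM, intrN); ring.
by apply: is_square_res; rewrite // rmorphN /= oppr_eq0 !intrM !mulf_neq0.
Qed.

(* At a prime dividing m the local points of E_d already fill all square
   classes: when -2 d is a square, the point of abscissa -4 d (or m d) has a
   nonsquare unit coordinate because 2 is a nonsquare. *)
Lemma covering_soluble_bad_unit :
  nonsquare (res 2) -> res d != 0 -> res m = 0 -> res delta != 0 -> soluble.
Proof.
move=> n2 d0 m0 D0.
have [nD|sD] := boolP (nonsquare (res delta)); last first.
  by left; apply: is_square_res.
have e0 : res (- (2 * d)) != 0 by rewrite rmorphN /= oppr_eq0 intrM mulf_neq0.
have [ne|se] := boolP (nonsquare (res (- (2 * d)))).
  apply: (@covering_soluble_at _ _ _ _ _ (- (2 * d))%:~R) => //; last first.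
    by rewrite subrr mulr0 mul0r; exact: is_square0.
  rewrite -intrM; apply: is_square_res; rewrite // intrM ?mulf_neq0 //.
  by rewrite nonsquareM // nD ne.
apply: (@covering_soluble_at _ _ _ _ _ (2 * - (2 * d))%:~R) => //.
  rewrite -intrM; apply: is_square_res; rewrite // !intrM ?mulf_neq0 //.
  by rewrite !nonsquareM ?mulf_neq0 // nD n2 (negPf se).
(* At [x = -4 d] one has [(x - e2) (x - e3) = (2 d)^2 (m + 2)], and [m + 2] is 2 modulo [p]. *)
apply: (@is_square_eqM _ _ (delta * (m + 2))%:~R (2 * d)%:~R).
  by rewrite !(intrM, intrN, intrD); ring.
have De : res (delta * (m + 2)) = res delta * res 2.
  by rewrite intrM intrD m0 add0r.
apply: is_square_res; rewrite // De ?mulf_neq0 //.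
by rewrite nonsquareM // nD n2.
Qed.

(** Put [n = - delta1 m1]. Up to squares, abscissa 0 asks that [n] be a square, [e3] that [-2 n d]
    be one, and [m d] that [- n d] and [n (m + 2)], congruent to [2 n], be squares. As 2 is a
    nonsquare, one of the three succeeds. *)
Lemma covering_soluble_bad_ramified (delta1 m1 : int) :
  delta = p%:Z * delta1 -> m = p%:Z * m1 ->
  nonsquare (res 2) -> res d != 0 -> res m1 != 0 -> res delta1 != 0 -> soluble.
Proof.
move=> D1 D2 n2 d0 m0 D0.
have m_eq0 : res m = 0.
  by rewrite D2 intrM (_ : res p%:Z = 0) ?mul0r //; apply/eqP; rewrite intr_Fp_eq0.
have u0 : res (- (delta1 * m1)) != 0 by rewrite rmorphN /= oppr_eq0 intrM mulf_neq0.
have [nD|sD] := boolP (nonsquare (res (- (delta1 * m1)))); last first.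
  apply: (@covering_soluble_at _ _ _ _ _ 0) => //.
    by rewrite mulr0; exact: is_square0.
  apply: (@is_square_eqM _ _ (- (delta1 * m1))%:~R (2 * p%:Z * d)%:~R).
    by rewrite D1 D2 !(intrM, intrN); ring.
  exact: is_square_res.
have e0 : res (- (2 * d)) != 0 by rewrite rmorphN /= oppr_eq0 intrM mulf_neq0.
have [ne|se] := boolP (nonsquare (res (- (2 * d)))).
  apply: (@covering_soluble_at _ _ _ _ _ (2 * m * d)%:~R) => //; last first.
    by rewrite subrr mulr0; exact: is_square0.
  apply: (@is_square_eqM _ _ (- (delta1 * m1) * - (2 * d))%:~R p%:R).
    by rewrite D1 D2 !(intrM, intrN); ring.
  apply: is_square_res; rewrite // intrM ?mulf_neq0 //.
  by rewrite nonsquareM // nD ne.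
have nd : nonsquare (res (- d)).
  apply: contraNT se => sd; rewrite -mulrN intrM nonsquareM ?n2 ?sd //.
  by rewrite rmorphN /= oppr_eq0.
have ndd : res (- d) != 0 by rewrite rmorphN /= oppr_eq0.
apply: (@covering_soluble_at _ _ _ _ _ (m * d)%:~R) => //.
  apply: (@is_square_eqM _ _ (- (delta1 * m1) * - d)%:~R p%:R).
    by rewrite D1 D2 !(intrM, intrN); ring.
  apply: is_square_res; rewrite // intrM ?mulf_neq0 //.
  by rewrite nonsquareM // nD nd.
apply: (@is_square_eqM _ _ (- (delta1 * m1) * (m + 2))%:~R (p%:Z * d)%:~R).
  by rewrite D1 !(intrM, intrN, intrD) D2 intrM; ring.
have De : res (- (delta1 * m1) * (m + 2)) = res (- (delta1 * m1)) * res 2.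
  by rewrite intrM intrD m_eq0 add0r.
apply: is_square_res; rewrite // De ?mulf_neq0 //.
by rewrite nonsquareM // nD n2.
Qed.

End LocalSolubility.

(** For [delta] 3 modulo 8 the abscissa 0 works: [delta * e2 * e3] is [- m delta] up to squares, and
    [- 5 * 3] is 1 modulo 8. *)
Lemma covering_soluble_dyadic (p_pr : prime 2)
    (K : completion (FinitePlace p_pr)) (d m delta : int) : delta != 0 ->
  (8 %| m - 5)%Z -> (8 %| delta - 1)%Z || (8 %| delta - 3)%Z ->
  covering_soluble (completion_emb K) (- (2 * d))%:~R (2 * m * d)%:~R delta%:~R.
Proof.
move=> D0 m5 /orP[D1|D3]; first by left; apply: is_square_hensel2.
apply: (@covering_soluble_at _ _ _ _ _ 0); rewrite ?intr_eq0 //.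
  by rewrite mulr0; exact: is_square0.
apply: (@is_square_eqM _ _ (- (m * delta))%:~R (2 * d)%:~R).
  by rewrite !(intrM, intrN); ring.
apply: is_square_hensel2 => //.
rewrite (_ : _ - 1 = - ((m - 5) * delta) - 5 * (delta - 3) - 16); last by ring.
apply: rpredB => //; apply: rpredB; first by rewrite rpredN dvdz_mulr.
exact: dvdz_mull.
Qed.

Lemma covering_soluble_real (K : completion InfinitePlace) (e2 e3 delta : rat) :
  e2 * e3 < 0 -> delta != 0 -> covering_soluble (completion_emb K) e2 e3 delta.
Proof.
move=> e23 D0; have [D_gt0|D_le0] := ltP 0 delta.
  by left; apply: is_square_real.
apply: (@covering_soluble_at _ _ _ _ _ 0) => //.
  by rewrite mulr0; exact: is_square0.
apply: is_square_real; rewrite !sub0r -mulrA mulrNN.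
by rewrite nmulr_rgt0 // lt_neqAle D0.
Qed.

(** * The choice of delta *)

(** Pigeonhole: two distinct subsets of [G] have the same vector of bits, and their symmetric
    difference is the relation. *)
Lemma relation_of_card (T S : choiceType) (G : seq T) (P : seq S)
    (bit : S -> T -> bool) :
  uniq G -> uniq P -> (size P < size G)%N ->
  exists s : seq T, [/\ s != [::], uniq s, {subset s <= G} &
    {in P, forall p, \big[addb/false]_(x <- s) bit p x = false}].
Proof.
move=> uG uP PG.
pose phi (A : {set seq_sub G}) : {ffun seq_sub P -> bool} :=
  [ffun p => \big[addb/false]_(x in A) bit (val p) (val x)].
have /injectivePn[A [B AB phiAB]] : ~~ injectiveb phi.
  apply/negP => /injectiveP/leq_card.
  rewrite -[X in (X <= _)%N]cardsT -powersetT card_powerset cardsT.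
  by rewrite card_ffun card_bool leq_exp2l // !card_seq_sub // leqNgt PG.
pose C := (A :\: B) :|: (B :\: A).
exists [seq val x | x <- enum C]; split.
- rewrite -size_eq0 size_map -cardE cards_eq0 finset.setU_eq0.
  by rewrite !finset.setD_eq0 -finset.eqEsubset.
- by rewrite (map_inj_uniq val_inj) enum_uniq.
- by move=> _ /mapP[x _ ->]; exact: valP.
- move=> p pP; rewrite big_map big_enum /=.
  have := congr1 (fun h : {ffun seq_sub P -> bool} => h (SeqSub pP)) phiAB.
  rewrite !ffunE /= (big_setID B) /= [in RHS](big_setID A) /=.
  rewrite [B :&: A]finset.setIC => /addbI e.
  have dis : [disjoint A :\: B & B :\: A].
    rewrite -finset.setI_eq0; apply/eqP/finset.setP => x.
    by rewrite !inE; case: (x \in A); rewrite ?andbF.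
  rewrite (eq_bigl [in [predU A :\: B & B :\: A]]) => [|x]; last by rewrite !inE.
  by rewrite bigU //= e addbb.
Qed.

Lemma logn_square (n : int) (p : nat) :
  is_square (idfun : {rmorphism rat -> rat}) n%:~R -> ~~ odd (logn p `|n|).
Proof.
case=> r /= Dr; have [->|n0] := eqVneq n 0; first by rewrite logn0.
have r0 : r != 0 by rewrite -sqrf_eq0 Dr intr_eq0.
have e : (numq r) ^+ 2 = n * (denq r) ^+ 2.
  apply: (@intr_inj rat); by rewrite !expr2 !intrM numqE -Dr; ring.
have := congr1 (fun z : int => odd (logn p `|z|)) e => /=.
rewrite abszM !abszX lognM ?expn_gt0 ?absz_gt0 ?denq_eq0 ?n0 //.
by rewrite !lognX oddD !oddM /= addbF => <-.
Qed.

Lemma nonsquare_prod (p : nat) (p_pr : prime p) (T : eqType) (g : T -> int)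
    (s : seq T) :
  {in s, forall x, (g x)%:~R != 0 :> 'F_p} ->
  (\prod_(x <- s) g x)%:~R != 0 :> 'F_p /\
  nonsquare ((\prod_(x <- s) g x)%:~R : 'F_p) =
    \big[addb/false]_(x <- s) nonsquare ((g x)%:~R : 'F_p).
Proof.
elim: s => [|x s IHs] s0.
  rewrite !big_nil oner_eq0; split=> //.
  by apply/negbTE/nonsquareP; exists 1; rewrite expr1n.
have [|IH0 IH] := IHs.
  by move=> y ys; apply: s0; rewrite inE ys orbT.
have x0 : (g x)%:~R != 0 :> 'F_p by apply: s0; rewrite mem_head.
by rewrite !big_cons intrM mulf_neq0 // nonsquareM // IH.
Qed.

(** On odd integers, the character modulo 8 with kernel {1, 3}, the classes accepted by
    [covering_soluble_dyadic]. *)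
Definition dyadic_class (x : int) : bool := (x %% 8)%Z \in [:: 5; 7].

Lemma dyadic_class_prod (s : seq int) : {in s, forall x, ~~ (2 %| x)%Z} ->
  ~~ (2 %| \prod_(x <- s) x)%Z /\
  dyadic_class (\prod_(x <- s) x) = \big[addb/false]_(x <- s) dyadic_class x.
Proof.
elim: s => [|x s IHs] s2; first by rewrite !big_nil.
have [|IH0 IH] := IHs.
  by move=> y ys; apply: s2; rewrite inE ys orbT.
have x2 : ~~ (2 %| x)%Z by apply: s2; rewrite mem_head.
rewrite !big_cons -IH; move: (\prod_(_ <- s) _) IH0 => y y2.
move: x2 y2; rewrite /dyadic_class !inE.
have e z : (2 %| z)%Z = ((z %% 8)%Z \in [:: 0; 2; 4; 6]).
  by rewrite !inE; lia.
rewrite !e -modzMm !inE.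
have := modz_ge0 x (isT : 8 != 0 :> int); have := ltz_mod x (isT : 8 != 0 :> int).
have := modz_ge0 y (isT : 8 != 0 :> int); have := ltz_mod y (isT : 8 != 0 :> int).
by case: (x %% 8)%Z => // -[|[|[|[|[|[|[|[|?]]]]]]]] //;
  case: (y %% 8)%Z => // -[|[|[|[|[|[|[|[|?]]]]]]]].
Qed.

Lemma logn_prod_signed_primes (p : nat) (s : seq int) : prime p -> uniq s ->
  {in s, forall x, x = -1 \/ exists2 q, prime q & x = q%:Z} ->
  \prod_(x <- s) x != 0 /\ logn p `|\prod_(x <- s) x| = (p%:Z \in s).
Proof.
move=> p_pr; elim: s => [|x s IHs] /= us s_pr; first by rewrite big_nil logn1.
have /andP[xs us'] := us.
have [||IH0 IH] := IHs => //.
  by move=> y ys; apply: s_pr; rewrite inE ys orbT.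
have [x1|[q q_pr xq]] := s_pr x (mem_head _ _).
  rewrite big_cons x1 mulf_neq0 // abszM mul1n IH inE; split; first by [].
  by rewrite (_ : (p%:Z == -1) = false).
have q0 : q%:Z != 0 by rewrite eqz_nat -lt0n prime_gt0.
rewrite big_cons xq mulf_neq0 // abszM lognM ?absz_gt0 // IH logn_prime // inE.
split=> //; rewrite eqz_nat; case: eqP => // /= pq.
by move: xs; rewrite xq -pq => /negbTE ->.
Qed.

Lemma is_square_ge0 (x : rat) : is_square (idfun : {rmorphism rat -> rat}) x -> 0 <= x.
Proof. by case=> r /= <-; exact: sqr_ge0. Qed.

(* From p = a^2 + 2 b^2 the class of -2 is a square, while -1 is not. *)
Lemma nonsquare2_mod4 (p a b : nat) : prime p -> p = 3 %[mod 4] ->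
  p = (a ^ 2 + 2 * b ^ 2)%N -> ~~ (p %| b)%N -> nonsquare (2%:~R : 'F_p).
Proof.
move=> p_pr p3 Dp pb; apply/negPn/negP => /nonsquareP[y Dy].
have b0 : b%:R != 0 :> 'F_p by rewrite -(dvdn_pcharf (pchar_Fp p_pr)).
have p_odd : odd p by rewrite -(odd_mod p (erefl : odd 4 = false)) p3.
have two0 : (2%:R : 'F_p) != 0.
  rewrite -(dvdn_pcharf (pchar_Fp p_pr)) gtnNdvd //.
  by have := odd_gt2 p_odd (prime_gt1 p_pr).
have y0 : y != 0 by rewrite -sqrf_eq0 Dy.
pose t := a%:R / (b%:R * y).
have t2 : t ^+ 2 = -1.
  have e : a%:R ^+ 2 + 2%:R * b%:R ^+ 2 = 0 :> 'F_p.
    by rewrite -!natrX -natrM -natrD -Dp pchar_Fp_0.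
  have -> : -1 = - (2%:R * b%:R ^+ 2) / (b%:R * y) ^+ 2.
    by rewrite exprMn Dy; field; rewrite b0 two0.
  by rewrite expr_div_n; congr (_ / _); apply/eqP; rewrite -addr_eq0 e.
have tp : t ^+ p = t by rewrite -[X in _ ^+ X](card_Fp p_pr) expf_card.
(* As [p] is 3 modulo 4 and [t ^+ 2 = -1], this contradicts Fermat's [t ^+ p = t]. *)
have : t ^+ p = - t.
  have Dq : p = (4 * (p %/ 4) + (2 + 1))%N by rewrite {1}(divn_eq p 4) p3 mulnC.
  rewrite [X in _ ^+ X]Dq exprD exprM (exprM t 2 2) t2 sqrrN !expr1n mul1r.
  by rewrite exprD t2 mulN1r.
rewrite tp => /eqP; rewrite -addr_eq0 -mulr2n -mulr_natl mulf_eq0 (negPf two0) /=.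
by move/eqP=> t0; move: t2; rewrite t0 expr0n => /eqP; rewrite eq_sym oppr_eq0 oner_eq0.
Qed.

(** Since 29 is 1 modulo 4, [nonsquare2_mod4] does not apply; the residues are squared one by
    one. *)
Lemma nonsquare2_mod29 : nonsquare (2%:~R : 'F_29).
Proof. by apply/forallP => -[] ; do 29!case=> //. Qed.

(** * Factored forms of the twists, and the local conditions on delta *)

Lemma quadratic_twist_eq (F F' : curve) (d : rat) :
  a2 F * d = a2 F' -> a4 F * d ^+ 2 = a4 F' -> a6 F * d ^+ 3 = a6 F' ->
  quadratic_twist F d = F'.
Proof. by case: F' => ? ? ? /= <- <- <-. Qed.

(** The roots come from [708584 = 2 (m - 1)] and [1417172 = 4 m]. *)
Lemma twist_E (d m : int) : m = 19 * 29 * 643 ->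
  quadratic_twist E d%:~R =
    full_torsion_curve (- (2 * d))%:~R (2 * m * d)%:~R.
Proof.
move=> ->; apply: quadratic_twist_eq; rewrite /E /full_torsion_curve;
  by cbv beta iota delta [a2 a4 a6]; ring.
Qed.

Lemma twist_E' (d m : int) : m = 19 * 29 * 643 ->
  quadratic_twist E' d%:~R = isogenous_curve (- (2 * d))%:~R (2 * m * d)%:~R.
Proof.
move=> ->; apply: quadratic_twist_eq; rewrite /E' /isogenous_curve;
  by cbv beta iota delta [a2 a4 a6]; ring.
Qed.

(* At a prime p dividing d the Selmer condition on delta = p delta1 concerns
   the unit - 2 delta1 (d / p), which is - 2 d delta up to a square. *)
Definition unit_part (d p : nat) (x : int) : int :=
  if x == p%:Z then - (2 * (d %/ p)%N%:Z) else x.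

(** Summed over the factors of [delta] with [addb], these bits express the sign condition at [p]. *)
Definition local_class (d p : nat) (x : int) : bool :=
  if p == 2%N then dyadic_class x else nonsquare ((unit_part d p x)%:~R : 'F_p).

Section Selmer.
Variable d : nat.
Hypotheses (d_gt0 : (0 < d)%N) (d_sqf : squarefree d) (d_cop : coprime d N_E).

Lemma bad_prime_ndvd (r : nat) : r \in [:: 2; 3; 19; 29; 643]%N -> ~~ (r %| d)%N.
Proof.
have ndvd q : prime q -> coprime d q -> ~~ (q %| d)%N.
  by move=> q_pr; rewrite coprime_sym prime_coprime.
move: d_cop; rewrite /N_E 4!coprimeMr coprime_pexpr //.
move=> /andP[/andP[/andP[/andP[c2 c3] c19] c29] c643].
by rewrite !inE => /or4P[/eqP->|/eqP->|/eqP->|/orP[/eqP->|/eqP->]]; apply: ndvd.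
Qed.

(** One generator more than the conditions at 2, 3 and the primes of [d]; at 19, 29 and 643
    solubility is automatic. Leaving out 2 and 29 keeps [delta] away from the classes of [e2], [e3]
    and [e2 e3]. *)
Let gens : seq int := [:: -1, 19%:Z, 643%:Z & [seq q%:Z | q <- primes d]].

Lemma selmer_relation : exists s : seq int,
  [/\ s != [::], uniq s, {subset s <= gens} &
    {in [:: 2, 3 & primes d]%N, forall p,
       \big[addb/false]_(x <- s) local_class d p x = false}].
Proof.
have np r : r \in [:: 2; 3; 19; 29; 643]%N -> r \notin primes d.
  by move=> /bad_prime_ndvd; apply: contraNN; rewrite mem_primes => /and3P[].
have npz r : r \in [:: 2; 3; 19; 29; 643]%N -> r%:Z \notin [seq q%:Z | q <- primes d].
  by move=> /np; rewrite mem_map // => ? ? [].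
apply: relation_of_card; last by rewrite /= size_map.
  rewrite /gens /= !inE /= !npz // map_inj_uniq ?primes_uniq ?andbT //; last by move=> ? ? [].
  by apply/mapP => -[].
by rewrite /= !inE /= !np ?primes_uniq.
Qed.

Variable s : seq int.
Hypotheses (s_uniq : uniq s) (s_gens : {subset s <= gens}).
Hypothesis s_class :
  {in [:: 2, 3 & primes d]%N, forall p,
     \big[addb/false]_(x <- s) local_class d p x = false}.

Let delta : int := \prod_(x <- s) x.

Lemma mem_gens (x : int) : x \in s ->
  x = -1 \/ exists q, [/\ prime q, x = q%:Z & [|| q == 19%N, q == 643%N | (q %| d)%N]].
Proof.
move=> /s_gens; rewrite !inE => /or4P[/eqP->|/eqP->|/eqP->|/mapP[q]].
- by left.
- by right; exists 19.
- by right; exists 643.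
rewrite mem_primes => /and3P[q_pr _ qd ->]; right; exists q.
by rewrite qd !orbT.
Qed.

Lemma delta_logn (p : nat) : prime p -> logn p `|delta| = (p%:Z \in s).
Proof.
move=> p_pr; have [|_ //] := logn_prod_signed_primes p_pr s_uniq.
by move=> x /mem_gens[->|[q [q_pr -> _]]]; [left | right; exists q].
Qed.

Lemma delta_neq0 : delta != 0.
Proof.
have [|//] := logn_prod_signed_primes (isT : prime 2) s_uniq.
by move=> x /mem_gens[->|[q [q_pr -> _]]]; [left | right; exists q].
Qed.

Lemma gens_prime (p : nat) : prime p -> p%:Z \in s ->
  [|| p == 19%N, p == 643%N | (p %| d)%N].
Proof.
move=> p_pr /mem_gens[//|[q [_ [->]]]].
by [].
Qed.

Lemma gens_bad_prime (p : nat) : p \in [:: 2; 3; 29]%N -> p%:Z \notin s.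
Proof.
move=> p_bad.
have [p_pr ndvd] : prime p /\ ~~ (p %| d)%N.
  split; last by apply: bad_prime_ndvd; move: p_bad; rewrite !inE => /or3P[]/eqP->.
  by move: p_bad; rewrite !inE => /or3P[]/eqP->.
apply/negP => /(gens_prime p_pr); rewrite (negPf ndvd) orbF.
by move: p_bad; rewrite !inE => /or3P[]/eqP->.
Qed.

Lemma gens_neq0 (p : nat) (x : int) : prime p -> x \in s -> x != p%:Z ->
  x%:~R != 0 :> 'F_p.
Proof.
move=> p_pr /mem_gens[->|[q [q_pr -> _]]] qp.
  by rewrite rmorphN /= oppr_eq0 oner_eq0.
by rewrite intr_Fp_eq0 // dvdzE /= dvdn_prime2 // eq_sym.
Qed.

Lemma delta_intr_neq0 (p : nat) : prime p -> p%:Z \notin s -> delta%:~R != 0 :> 'F_p.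
Proof.
move=> p_pr ps; have [] := @nonsquare_prod p p_pr _ id s => // x xs.
by apply: gens_neq0 => //; apply: contraNneq ps => <-.
Qed.

Lemma delta_ramified (p : nat) : prime p -> p%:Z \in s ->
  delta = p%:Z * \prod_(x <- rem p%:Z s) x /\
  (\prod_(x <- rem p%:Z s) x)%:~R != 0 :> 'F_p.
Proof.
move=> p_pr ps; rewrite /delta (perm_big _ (perm_to_rem ps)) big_cons; split=> //.
have [] := @nonsquare_prod p p_pr _ id (rem p%:Z s) => // x.
by rewrite mem_rem_uniq // inE => /andP[xp xs]; apply: gens_neq0.
Qed.

Lemma twist_prime (p : nat) : prime p -> (p %| d)%N ->
  d%:Z = p%:Z * (d %/ p)%N%:Z /\ (d %/ p)%N%:Z%:~R != 0 :> 'F_p.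
Proof.
move=> p_pr pd; split; first by rewrite -PoszM mulnC divnK.
rewrite intr_Fp_eq0 // dvdzE /=; apply/negP => pp.
have : p = 1%N.
  by apply: d_sqf; rewrite -(divnK pd) expnS expn1 dvdn_mul.
by move=> p1; rewrite p1 in p_pr.
Qed.

Lemma delta_locally_soluble (p : nat) (p_pr : prime p)
    (K : completion (FinitePlace p_pr)) (m : int) : m = 19 * 29 * 643 ->
  covering_soluble (completion_emb K) (- (2 * d%:Z))%:~R (2 * m * d%:Z)%:~R delta%:~R.
Proof.
move=> Dm; have D0 := delta_neq0.
have [p2|p_neq2] := eqVneq p 2%N.
  subst p; apply: covering_soluble_dyadic => //; first by rewrite Dm.
  have [odd_s class_s] : ~~ (2 %| delta)%Z /\
      dyadic_class delta = \big[addb/false]_(x <- s) dyadic_class x.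
    apply: dyadic_class_prod => x xs; have := @gens_neq0 2 x isT xs.
    rewrite intr_Fp_eq0 //; apply.
    by apply: contraTneq xs => ->; apply: gens_bad_prime.
  have := s_class (mem_head _ _); rewrite /local_class /= -class_s /dyadic_class.
  rewrite !inE; move: odd_s; lia.
have p_odd : odd p by case: (even_prime p_pr) p_neq2 => [->|].
have [p_cond|p_cond] := boolP (p \in 3%N :: primes d).
  have p_class :
      \big[addb/false]_(x <- s) nonsquare ((unit_part d p x)%:~R : 'F_p) = false.
    rewrite -[RHS](s_class (x := p)); last by rewrite inE p_cond orbT.
    by rewrite /local_class (negPf p_neq2).
  have [ps|ps] := boolP (p%:Z \in s); last first.
    (* When [p] does not divide [delta], the condition says that [delta] itself is a square modulo
       [p]. *)
    left; apply: is_square_res => //; first exact: delta_intr_neq0.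
    have [|_ ->] := @nonsquare_prod p p_pr _ id s.
      by move=> x xs; apply: gens_neq0 => //; apply: contraNneq ps => <-.
    apply/negbT; rewrite -[RHS]p_class; apply: eq_big_seq => x xs.
    by rewrite /unit_part ifN //; apply: contraNneq ps => <-.
  have pd : (p %| d)%N.
    move: p_cond; rewrite inE mem_primes => /orP[/eqP p3|/and3P[] //].
    by have := @gens_bad_prime 3 isT; rewrite -p3 ps.
  have [Dd d1] := twist_prime p_pr pd.
  have [Dd' delta1] := delta_ramified p_pr ps.
  apply: (covering_soluble_twist_prime _ _ p_odd D0 Dd' Dd) => //.
  have [|_ sq] := @nonsquare_prod p p_pr _ (unit_part d p) s.
    move=> x xs; rewrite /unit_part; have [_|xp] := eqVneq x p%:Z; last first.
      exact: gens_neq0.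
    by rewrite rmorphN /= oppr_eq0 intrM mulf_neq0 // intr2_Fp_neq0.
  (* In the product of unit parts only the factor [p] has changed, into [-2 (d / p)], so the
     condition is the one at the abscissa [e2]. *)
  move: sq; rewrite p_class (perm_big _ (perm_to_rem ps)) big_cons /=.
  rewrite {1}/unit_part eqxx.
  rewrite (eq_big_seq (fun x => x)) => [|x]; last first.
    by rewrite mem_rem_uniq // inE /unit_part => /andP[/negbTE ->].
  set P := \prod_(_ <- _) _ => sq.
  have -> : - (2 * P * (d %/ p)%N%:Z) = - (2 * (d %/ p)%N%:Z) * P by ring.
  by rewrite sq.
move: p_cond; rewrite inE mem_primes p_pr d_gt0 /= negb_or => /andP[p3 pd].
have d0 : d%:Z%:~R != 0 :> 'F_p by rewrite intr_Fp_eq0.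
have [p_bad|p_good] := boolP (p \in [:: 19; 29; 643]%N).
  have n2 : nonsquare (2%:~R : 'F_p).
    move: p_bad; rewrite !inE => /or3P[]/eqP->.
    - by apply: (@nonsquare2_mod4 19 1 3).
    - exact: nonsquare2_mod29.
    - by apply: (@nonsquare2_mod4 643 25 3).
  have [m1 [Dm1 m10]] : exists m1 : int, m = p%:Z * m1 /\ m1%:~R != 0 :> 'F_p.
    move: p_bad; rewrite !inE => /or3P[]/eqP->.
    - exists (29 * 643); split; first by rewrite Dm; ring.
      by rewrite intr_Fp_eq0.
    - exists (19 * 643); split; first by rewrite Dm; ring.
      by rewrite intr_Fp_eq0.
    - exists (19 * 29); split; first by rewrite Dm; ring.
      by rewrite intr_Fp_eq0.
  have [ps|ps] := boolP (p%:Z \in s).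
    have [Dd' delta1] := delta_ramified p_pr ps.
    exact: (covering_soluble_bad_ramified _ p_odd D0 Dd' Dm1).
  apply: covering_soluble_bad_unit => //; last exact: delta_intr_neq0.
  by rewrite Dm1 intrM (_ : p%:Z%:~R = 0) ?mul0r //; apply/eqP; rewrite intr_Fp_eq0.
have ps : p%:Z \notin s.
  apply/negP => /(gens_prime p_pr); rewrite (negPf pd) orbF.
  by move: p_good; rewrite !inE => /norP[/negbTE-> /norP[_ /negbTE->]].
have prime_neq0 q : prime q -> p != q -> q%:Z%:~R != 0 :> 'F_p.
  by move=> q_pr pq; rewrite intr_Fp_eq0 // dvdzE /= dvdn_prime2.
move: p_good; rewrite !inE !negb_or => /and3P[p19 p29 p643].
apply: covering_soluble_good => //; first exact: delta_intr_neq0.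
  rewrite Dm 2!intrM; apply: mulf_neq0; first apply: mulf_neq0.
  - exact: (prime_neq0 19%N).
  - exact: (prime_neq0 29%N).
  - exact: (prime_neq0 643%N).
(* Thus the roots 0, [e2] and [e3] stay distinct modulo [p]. *)
have -> : m + 1 = 2 * 3 ^+ 11 by rewrite Dm; ring.
rewrite intrM rmorphXn /=; apply: mulf_neq0; last apply: expf_neq0.
- exact: (prime_neq0 2%N).
- exact: (prime_neq0 3%N).
Qed.

End Selmer.

(** * Nontriviality over Q and the conclusion *)

(** For [z] nonzero, [(delta z^2, delta z N)] is a rational point of [full_torsion_curve e2 e3], and
    its abscissa has the class of [delta]. *)
Lemma covering_soluble_rat (e2 e3 delta : rat) :
  e2 * e3 < 0 -> ~ is_square idfun (e2 * (e2 - e3)) ->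
  ~ is_square idfun (e3 * (e3 - e2)) ->
  finite_set (rational_points (full_torsion_curve e2 e3)) -> delta != 0 ->
  covering_soluble idfun e2 e3 delta ->
  [\/ is_square idfun delta, is_square idfun (delta * (e2 * e3)),
      is_square idfun (delta * e2) | is_square idfun (delta * e3)].
Proof.
move=> e23 n2 n3 fin D0 [|[z [N /= zN]]]; first by constructor 1.
have [z0|z0] := eqVneq z 0.
  constructor 2; exists (delta * N) => /=.
  by rewrite exprMn expr2 -mulrA zN z0; ring.
have yx : (delta * z * N) ^+ 2 =
    delta * z ^+ 2 * (delta * z ^+ 2 - e2) * (delta * z ^+ 2 - e3).
  transitivity (delta * z ^+ 2 * (delta * N ^+ 2)); first by ring.
  by rewrite zN; ring.
have x0 : delta * z ^+ 2 != 0 by rewrite mulf_neq0 // expf_neq0.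
have scale c : is_square idfun (delta * z ^+ 2 * c) -> is_square idfun (delta * c).
  by apply: (@is_square_eqM _ _ _ z^-1); field.
have [h|/scale h|/scale h|/scale h] := descent_image e23 n2 n3 fin yx x0.
- by constructor 1; rewrite -[delta]mulr1; apply: scale; rewrite mulr1.
- by constructor 2.
- by constructor 3.
- by constructor 4.
Qed.

Lemma not_square_ramified (q : nat) (t u : int) : prime q -> t != 0 ->
  u%:~R != 0 :> 'F_q ->
  ~ is_square (idfun : {rmorphism rat -> rat}) (q%:Z * t ^+ 2 * u)%:~R.
Proof.
move=> q_pr t0 u0 /(logn_square q).
have q_u : ~~ (q %| `|u|)%N by rewrite intr_Fp_eq0 // dvdzE in u0.
have u_gt0 : (0 < `|u|)%N.
  by rewrite absz_gt0; apply: contraNneq u0 => ->; rewrite mulr0z.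
have t_gt0 : (0 < `|t| ^ 2)%N by rewrite expn_gt0 absz_gt0 t0.
have q_gt0 := prime_gt0 q_pr.
have qt_gt0 : (0 < q * `|t| ^ 2)%N by rewrite muln_gt0 q_gt0.
rewrite abszM abszM abszX (lognM q qt_gt0 u_gt0) (lognM q q_gt0 t_gt0).
rewrite lognX mul2n logn_prime // eqxx (lognE q `|u|) (negPf q_u) !andbF 2!oddD odd_double.
by [].
Qed.

Section Main.
Variable d : nat.
Hypotheses (d_gt0 : (0 < d)%N) (d_sqf : squarefree d) (d_cop : coprime d N_E).
Variable m : int.
Hypothesis Dm : m = 19 * 29 * 643.

Let e2 : rat := (- (2 * d%:Z))%:~R.
Let e3 : rat := (2 * m * d%:Z)%:~R.

(** Grouped as 2, a square and an odd factor, to suit [not_square_ramified]. *)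
Let m1 : m + 1 = 2%:Z * (3 ^+ 5) ^+ 2 * 3. Proof. by rewrite Dm; ring. Qed.

Let d_neq0 : d%:Z != 0. Proof. by rewrite eqz_nat -lt0n. Qed.

Let m_gt0 : 0 < m. Proof. by rewrite Dm. Qed.

Let roots_lt0 : e2 * e3 < 0.
Proof.
by rewrite -intrM ltrz0 mulNr oppr_lt0 !pmulr_rgt0.
Qed.

Let roots_nsq2 : ~ is_square idfun (e2 * (e2 - e3)).
Proof.
rewrite -intrB -intrM (_ : _ * _ = 2%:Z * (2 * d%:Z * 3 ^+ 5) ^+ 2 * 3).
  by apply: not_square_ramified => //; rewrite !mulf_neq0.
transitivity (4 * d%:Z ^+ 2 * (m + 1)); first by ring.
by rewrite m1; ring.
Qed.

Let m_odd : m%:~R != 0 :> 'F_2.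
Proof.
rewrite Dm 2!intrM; apply: mulf_neq0; first apply: mulf_neq0;
  by rewrite intr_Fp_eq0.
Qed.

Let roots_nsq3 : ~ is_square idfun (e3 * (e3 - e2)).
Proof.
rewrite -intrB -intrM (_ : _ * _ = 2%:Z * (2 * d%:Z * 3 ^+ 5) ^+ 2 * (3 * m)).
  apply: not_square_ramified => //.
    by rewrite !mulf_neq0.
  by rewrite intrM; apply: mulf_neq0 => //; rewrite intr_Fp_eq0.
transitivity (4 * d%:Z ^+ 2 * m * (m + 1)); first by ring.
by rewrite m1; ring.
Qed.

Lemma selmer_element_sha :
  finite_set (rational_points (full_torsion_curve e2 e3)) ->
  sha_2torsion_nontrivial (isogenous_curve e2 e3).
Proof.
move=> fin.
have [s [s0 s_uniq s_gens s_class]] := selmer_relation d_cop.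
pose delta : int := \prod_(x <- s) x.
have D0 : delta%:~R != 0 :> rat by rewrite intr_eq0 (delta_neq0 s_uniq s_gens).
have e2_neq0 : e2 != 0 by apply: contraTneq roots_lt0 => ->; rewrite mul0r ltxx.
have e3_neq0 : e3 != 0 by apply: contraTneq roots_lt0 => ->; rewrite mulr0 ltxx.
have e23 : e2 != e3.
  by apply: contraTneq roots_lt0 => ->; rewrite -leNgt -expr2 sqr_ge0.
pose w : algC := sqrtC (ratr delta%:~R).
have w2 : w ^+ 2 = ratr delta%:~R by rewrite sqrtCK.
exists (torsion_cocycle e2 e3 w); split.
- split; first exact: torsion_cocycleP w2.
  move=> v K L j; apply: (torsion_cocycle_restr_coboundary e2_neq0 e3_neq0 e23 D0 w2).
  move: v K L j => [|p p_pr] K L j.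
    exact: covering_soluble_real.
  exact: delta_locally_soluble.
- exact: torsion_cocycle_double.
- move/(torsion_cocycle_coboundary e23 D0 w2).
  have d_odd : d%:Z%:~R != 0 :> 'F_2.
    by rewrite intr_Fp_eq0 // dvdzE (bad_prime_ndvd d_cop).
  have D_odd : delta%:~R != 0 :> 'F_2.
    by apply: (delta_intr_neq0 s_gens) => //; apply: (gens_bad_prime d_cop s_gens).
  case/(covering_soluble_rat roots_lt0 roots_nsq2 roots_nsq3 fin D0).
  + move=> sq_delta.
    (* A square has even valuations, so no prime lies in [s]; this leaves [delta = -1], which is
       negative. *)
    have all_m1 x : x \in s -> x = -1.
      move=> xs; have [//|[q [q_pr xq _]]] := mem_gens s_gens xs.
      have := logn_square q sq_delta; rewrite (delta_logn s_uniq s_gens) //.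
      by rewrite -xq xs.
    have Ds : s = [:: -1].
      have s_sub : {subset s <= [:: -1]} by move=> x /all_m1 ->; rewrite mem_head.
      have := uniq_leq_size s_uniq s_sub; case: (s) s0 all_m1 => [|x []] // _ all_m1 _.
      by rewrite (all_m1 x) ?mem_head.
    have := is_square_ge0 sq_delta.
    by rewrite /delta Ds big_seq1.
  (* The valuation at 29 is odd, because 29 divides [m] once and does not divide [delta]. *)
  + rewrite -!intrM (_ : _ * _ = 29%:Z * (2 * d%:Z) ^+ 2 * (- (19 * 643) * delta)); last first.
      by rewrite Dm; ring.
    apply: not_square_ramified => //; first by rewrite mulf_neq0.
    rewrite intrM; apply: mulf_neq0; first by rewrite intr_Fp_eq0.
    by apply: (delta_intr_neq0 s_gens) => //; apply: (gens_bad_prime d_cop s_gens).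
  (* In the last two cases the valuation at 2 is 1, since [d], [m] and [delta] are odd. *)
  + rewrite -!intrM (_ : _ * _ = 2%:Z * 1 ^+ 2 * (- d%:Z * delta)); last by ring.
    apply: not_square_ramified => //.
    by rewrite intrM mulf_neq0 // rmorphN /= oppr_eq0.
  + rewrite -!intrM (_ : _ * _ = 2%:Z * 1 ^+ 2 * (m * d%:Z * delta)); last by ring.
    apply: not_square_ramified => //.
    by rewrite !intrM !mulf_neq0.
Qed.

End Main.

Theorem theorem8 (d : nat) (hd_pos : (0 < d)%N) (hd_sqf : squarefree d)
    (hd_cop : coprime d N_E)
    (hfin : finite_set (rational_points (quadratic_twist E (d%:R)%R))) :
  sha_2torsion_nontrivial (quadratic_twist E' (d%:R)%R).
Proof.
(* Only the equation of [m] is kept, so that the large product stays unevaluated. *)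
have [m Dm] : exists m : int, m = 19 * 29 * 643 by eexists.
rewrite [d%:R]pmulrn in hfin *.
rewrite (twist_E d Dm) in hfin.
rewrite (twist_E' d Dm).
exact: selmer_element_sha hd_pos hd_sqf hd_cop _ Dm hfin.
Qed.
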